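(* Let $n\ge 2$ and let $f,h$ be two homeomorphisms of $S$ generating a faithful action $\langle f,h\rangle$ of $BS(1,n)$ on $S$ (so $h\circ f\circ h^{-1}=f^n$). Let $\Lambda$ be a minimal set of $\langle f,h\rangle$ contained in $\mathrm{Fix}(f)$, and suppose that $f$ and $h$ are $C^1_\Lambda$ (that is, $C^1$ on a neighborhood of $\Lambda$). 1. Every point $x\in\Lambda$ is an $f$-elliptic fixed point, in the sense that the eigenvalues of $D_xf$ are roots of unity. More precisely, there exists a positive integer $N$ such that, for every $x\in\Lambda$, the only eigenvalue of $D_xf^N$ is $1$. 2. Moreover, for every $\epsilon>0$ there exist $\delta>0$ and a $C^1_\Lambda$-diffeomorphism $f_\epsilon\in\langle f,h\rangle$ such that: (a) $f_\epsilon,h$ generate a faithful action of $BS(1,n)$ on $S$, and $\Lambda\subset \mathrm{Fix}(f_\epsilon)\subset \mathrm{Fix}(f^N)$, where $N$ is given by item 1; (b) $\|f_\epsilon-\mathrm{Id}\|_{B_\delta(\Lambda)}\le\epsilon$ (in other words, $B_\delta(\Lambda)\subset V_\epsilon(f_\epsilon)$). More precisely, $f_\epsilon$ is either $f^N$ or some $n^{k_\epsilon}$-th root of $f^N$ (that is, $f_\epsilon^{\,n^{k_\epsilon}}=f^N$) for some $k_\epsilon\in\mathbb N$.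
   Context: $S$ is a closed connected oriented surface embedded in $\mathbb R^3$; $\|\cdot\|$ is the Euclidean norm of $\mathbb R^3$, $d$ is the distance on $S$ associated with the induced Riemannian metric, and $\rho$ is the injectivity radius of its exponential map. $B_r(x)$ is the open $d$-ball with center $x$ and radius $r$ (radii are always $<\rho$), and $B_\delta(\Lambda)=\bigcup_{x\in\Lambda}B_\delta(x)$. $BS(1,n)=\langle a,b\mid aba^{-1}=b^n\rangle$. An action $\langle f,h\rangle$ of $BS(1,n)$ on $S$ is given by homeomorphisms $f,h$ of $S$ with $h\circ f\circ h^{-1}=f^n$ ($b$ acts by $f$ and $a$ by $h$); it is faithful if the corresponding homomorphism $BS(1,n)\to \mathrm{Homeo}(S)$ is injective. $\langle f,h\rangle$ also denotes the group generated by $f,h$. A minimal set of the action is a nonempty compact invariant set that is minimal for inclusion among such sets. $\mathrm{Fix}(f)$ is the set of fixed points of $f$. For a compact $F$-invariant set $\Lambda$, a map $F:S\to S$ is $C^1_\Lambda$ if it is $C^1$ on a neighborhood of $\Lambda$ in $S$. A $C^1_\Lambda$-diffeomorphism is a homeomorphism of $S$ that restricts to a $C^1$-diffeomorphism from a neighborhood of $\Lambda$ onto its image. $D_xF:T_xS\to T_{F(x)}S$ is the differential of $F$ at $x$. $\mathcal D_xF:T_xS\to\mathbb R^3$ is the differential of $F$ viewed as a map into $\mathbb R^3$, $\mathcal D_x(F-\mathrm{Id})v=\mathcal D_xF\,v-v$, and $\|\mathcal D_xF\|=\sup\{\|\mathcal D_xF\,v\|: v\in T_xS,\ \|v\|=1\}$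 (similarly for $F-\mathrm{Id}$). For a set $V$ on which $F$ is $C^1$, $\|F-\mathrm{Id}\|_V=\sup_{x\in V}\big(\|F(x)-x\|+\|\mathcal D_x(F-\mathrm{Id})\|\big)$. Finally $V_\epsilon(F)=\{x\in S:\ F \text{ is } C^1 \text{ at } x \text{ and } \|F(x)-x\|+\|\mathcal D_x(F-\mathrm{Id})\|<\epsilon\}$.
   Formalization: f and h are assumed to be C^1_Λ-diffeomorphisms (inverses also C^1 near Λ), not merely C^1 near Λ; otherwise f(z)=λz (0<λ<1), h(z)=|z|z on the sphere with n=2, Λ={0} is a counterexample. *)

(* Defs.v *)
From HB Require Import structures.
From mathcomp Require Import all_boot all_order all_algebra.
From mathcomp Require Import all_classical all_reals all_analysis.
From mathcomp Require Import complex.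

Set Implicit Arguments.
Unset Strict Implicit.
Unset Printing Implicit Defensive.

Import Order.TTheory GRing.Theory Num.Theory.
Import numFieldNormedType.Exports.

Local Open Scope classical_set_scope.
Local Open Scope ring_scope.

(* MathComp world.  The space R^k is 'rV[R]_k.  Its library norm `|_| is the
   sup norm, which has the right topology but is not Euclidean; lengths are
   measured with [enorm]. *)

Section Euclidean.
Context {R : realType}.

Definition dot k (u v : 'rV[R]_k) : R := \sum_(i < k) u 0 i * v 0 i.

Definition enorm k (v : 'rV[R]_k) : R := Num.sqrt (dot v v).

(* g is C^k on A, for an open set A *)
Fixpoint Ck_on (k : nat) (V W : normedModType R) (A : set V) (g : V -> W) :
    Prop :=
  match k with
  | 0 => forall x, A x -> {for x, continuous g}
  | k'.+1 => (forall x, A x -> differentiable g x) /\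
             (forall v, Ck_on k' A (fun x => 'D_v g x))
  end.

Definition smooth_on (V W : normedModType R) (A : set V) (g : V -> W) : Prop :=
  forall k, Ck_on k A g.

(* phi is a smooth parametrization of S `&` W by the open set U of R^2, whose
   inverse is the restriction of the map psi, smooth on the open set W of R^3 *)
Record parametrization (S : set 'rV[R]_3)
    (U : set 'rV[R]_2) (W : set 'rV[R]_3)
    (phi : 'rV[R]_2 -> 'rV[R]_3) (psi : 'rV[R]_3 -> 'rV[R]_2) : Prop :=
  Parametrization {
    param_openU : open U;
    param_openW : open W;
    param_smooth : smooth_on U phi;
    param_inv_smooth : smooth_on W psi;
    param_image : phi @` U = S `&` W;
    param_K : forall u, U u -> psi (phi u) = u }.

(* the tangent space of S at p, as a linear subspace of R^3 *)
Definition tangent (S : set 'rV[R]_3) (p : 'rV[R]_3) : set 'rV[R]_3 :=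
  [set v | exists U W phi psi, parametrization S U W phi psi /\
     exists u w, [/\ U u, phi u = p & v = 'd phi u w]].

End Euclidean.

(* An orientation is given by a continuous unit normal field. *)
Record closed_oriented_surface (R : realType) := ClosedOrientedSurface {
  carrier :> set 'rV[R]_3;
  unit_normal : 'rV[R]_3 -> 'rV[R]_3;
  surface_neq0 : carrier !=set0;
  surface_compact : compact carrier;
  surface_connected : connected carrier;
  surface_regular : forall p, carrier p ->
    exists U W phi psi, parametrization carrier U W phi psi /\ W p;
  unit_normal_continuous : {within carrier, continuous unit_normal};
  unit_normal_norm : forall p, carrier p -> enorm (unit_normal p) = 1;
  unit_normal_orth : forall p v, carrier p -> tangent carrier p v ->
    dot (unit_normal p) v = 0 }.

Section RiemannianDistance.
Context {R : realType} (S : set 'rV[R]_3).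

(* C^1 curves of S from x to y, parametrized by [0, 1].  Restricting to C^1
   curves instead of piecewise C^1 ones does not change the infimum of the
   lengths, because the velocity is allowed to vanish. *)
Definition curve_between (x y : S) (g : R -> 'rV[R]_3) : Prop :=
  [/\ forall t, derivable g t 1, continuous (derive1 g),
      forall t, 0 <= t <= 1 -> S (g t), g 0 = \val x & g 1 = \val y].

Definition curve_length (g : R -> 'rV[R]_3) : \bar R :=
  (\int[lebesgue_measure]_(t in `[0%R, 1%R]) (enorm (derive1 g t))%:E)%E.

Definition sdist (x y : S) : \bar R :=
  ereal_inf [set curve_length g | g in curve_between x y].

(* B_r(x) and B_r(L) *)
Definition sball (x : S) (r : R) : set S := [set y | (sdist x y < r%:E)%E].

Definition snbhd (L : set S) (r : R) : set S := \bigcup_(x in L) sball x r.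

End RiemannianDistance.

Section Differential.
Context {R : realType} (S : set 'rV[R]_3).

(* The map G, defined on S only, is C^1 at (i.e. near) x when it extends to a
   C^1 map on a neighborhood of x in R^3; the differential of G at x is the
   restriction to the tangent space of the differential of any extension. *)
Definition C1_extension (G : S -> 'rV[R]_3) (x : S)
    (H : 'rV[R]_3 -> 'rV[R]_3) : Prop :=
  exists W : set 'rV[R]_3, [/\ open W, W (\val x), Ck_on 1 W H &
    forall y : S, W (\val y) -> H (\val y) = G y].

Definition incl_map (F : S -> S) : S -> 'rV[R]_3 := fun y => \val (F y).

Definition C1_at (F : S -> S) (x : S) : Prop :=
  exists H, C1_extension (incl_map F) x H.

(* Meaningful when C1_at F x holds and v is tangent to S at x; see
   differentialE for the independence of the choice. *)
Definition differential (F : S -> S) (x : S) (v : 'rV[R]_3) : 'rV[R]_3 :=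
  'd (xget (cst 0) (C1_extension (incl_map F) x)) (\val x) v.

Lemma differentialE (F : S -> S) (x : S) H v :
  C1_extension (incl_map F) x H -> tangent S (\val x) v ->
  differential F x v = 'd H (\val x) v.
Proof.
move=> HF; rewrite /differential.
have : C1_extension (incl_map F) x
    (xget (cst 0) (C1_extension (incl_map F) x)) by apply: xgetI HF.
move: (xget _ _) => K [WK [oWK WKx [dK _] KF]].
case: HF => WH [oWH WHx [dH _] HF].
move=> [U [W [phi [psi [P [u [w [Uu phiu ->]]]]]]]].
have [dphi _] := param_smooth P 1.
have dphiu := dphi u Uu.
have e : {near u, K \o phi =1 H \o phi}.
  have cphi := differentiable_continuous dphiu.
  have nK : \forall z \near u, WK (phi z).
    by apply: cphi; rewrite phiu; exact: open_nbhs_nbhs.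
  have nH : \forall z \near u, WH (phi z).
    by apply: cphi; rewrite phiu; exact: open_nbhs_nbhs.
  have nU : \forall z \near u, U z.
    by apply: open_nbhs_nbhs; split => //; exact: param_openU P.
  near=> z.
  have Sz : S (phi z).
    suff : (S `&` W) (phi z) by case.
    by rewrite -(param_image P); exists z => //; near: z.
  pose y : S := exist _ (phi z) (mem_set Sz).
  have WKz : WK (phi z) by near: z.
  have WHz : WH (phi z) by near: z.
  by rewrite /= (KF y WKz) (HF y WHz).
have dKx : differentiable K (phi u) by rewrite phiu; exact: dK.
have dHx : differentiable H (phi u) by rewrite phiu; exact: dH.
have aux (g : 'rV[R]_3 -> 'rV[R]_3) : differentiable g (phi u) ->
    'd g (phi u) ('d phi u w) = 'D_w (g \o phi) u.
  move=> dg; rewrite (deriveE w (differentiable_comp dphiu dg)).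
  have E := diff_comp dphiu dg.
  exact: (esym (congr1 (fun k : 'rV[R]_2 -> 'rV[R]_3 => k w) E)).
suff main p : phi u = p -> 'd K p ('d phi u w) = 'd H p ('d phi u w).
  exact: main phiu.
move=> <-; apply: etrans (aux _ dKx) _; apply: etrans _ (esym (aux _ dHx)).
exact: near_eq_derive e.
Unshelve. all: by end_near. Qed.

(* Complex eigenvalues of D_x F, read on the matrix M of D_x F in a basis
   (the rows of B) of the tangent space; used at fixed points x of F. *)
Definition diff_eigenvalue (F : S -> S) (x : S) (l : R[i]) : Prop :=
  exists (B : 'M[R]_(2, 3)) (M : 'M[R]_2),
    [/\ row_free B,
        forall v, tangent S (\val x) v <-> (v <= B)%MS,
        forall i, differential F x (row i B) = row i M *m B
      & eigenvalue (map_mx (real_complex R) M) l].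

(* || D_x (F - Id) ||; it is finite whenever F is C^1 at x *)
Definition opnorm_diff_sub_id (F : S -> S) (x : S) : \bar R :=
  ereal_sup [set (enorm (differential F x v - v))%:E
            | v in [set v | tangent S (\val x) v /\ enorm v = 1]].

Definition C1_dist_id_at (F : S -> S) (x : S) : \bar R :=
  ((enorm (\val (F x) - \val x))%:E + opnorm_diff_sub_id F x)%E.

Definition C1_norm_sub_id (F : S -> S) (V : set S) : \bar R :=
  ereal_sup [set C1_dist_id_at F x | x in V].

(* V_eps(F) *)
Definition Veps (eps : R) (F : S -> S) : set S :=
  [set x | C1_at F x /\ (C1_dist_id_at F x < eps%:E)%E].

End Differential.

Record homeo (T : topologicalType) := Homeo {
  hfun :> T -> T;
  hinv : T -> T;
  hfunK : cancel hfun hinv;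
  hinvK : cancel hinv hfun;
  hfun_continuous : continuous hfun;
  hinv_continuous : continuous hinv }.

Definition Fix (T : Type) (f : T -> T) : set T := [set x | f x = x].

(* Words in the generators of BS(1,n): the letter (g, false) is g and the
   letter (g, true) is its inverse.  BS(1,n) is the quotient of the monoid of
   words by the congruence BS_eq n. *)
Inductive BS_gen := BS_a | BS_b.

Definition BS_word := seq (BS_gen * bool).

Inductive BS_eq (n : nat) : BS_word -> BS_word -> Prop :=
| BS_eq_refl w : BS_eq n w w
| BS_eq_sym w w' : BS_eq n w w' -> BS_eq n w' w
| BS_eq_trans w1 w2 w3 : BS_eq n w1 w2 -> BS_eq n w2 w3 -> BS_eq n w1 w3
| BS_eq_cat w1 w1' w2 w2' :
    BS_eq n w1 w1' -> BS_eq n w2 w2' -> BS_eq n (w1 ++ w2) (w1' ++ w2')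
| BS_eq_inv g e : BS_eq n [:: (g, e); (g, ~~ e)] [::]
| BS_eq_rel : BS_eq n [:: (BS_a, false); (BS_b, false); (BS_a, true)]
                      (nseq n (BS_b, false)).

Section Actions.
Context {T : topologicalType}.

Definition letter_act (f h : homeo T) (l : BS_gen * bool) : T -> T :=
  match l with
  | (BS_a, false) => h
  | (BS_a, true) => hinv h
  | (BS_b, false) => f
  | (BS_b, true) => hinv f
  end.

Definition word_act (f h : homeo T) (w : BS_word) : T -> T :=
  foldr (fun l g => letter_act f h l \o g) id w.

(* the group generated by f and h *)
Definition generated (f h : homeo T) : set (T -> T) :=
  range (word_act f h).

Definition BS_action (n : nat) (f h : homeo T) : Prop :=
  h \o f \o hinv h = iter n f.

Definition faithful_BS_action (n : nat) (f h : homeo T) : Prop :=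
  BS_action n f h /\
  forall w w', word_act f h w = word_act f h w' -> BS_eq n w w'.

Definition invariant_set (f h : homeo T) (L : set T) : Prop :=
  forall g, generated f h g -> g @` L `<=` L.

Definition minimal_set (f h : homeo T) (L : set T) : Prop :=
  [/\ L !=set0, compact L, invariant_set f h L &
      forall L' : set T, L' !=set0 -> compact L' -> invariant_set f h L' ->
        L' `<=` L -> L' = L].

End Actions.

(* C^1_L-diffeomorphism: F and its inverse are C^1 near L and near F(L) *)
Definition C1_diffeo_near (R : realType) (S : set 'rV[R]_3)
    (L : set S) (F : homeo S) : Prop :=
  exists V : set S, [/\ open V, L `<=` V,
    forall x, V x -> C1_at F x &
    forall y, (F @` V) y -> C1_at (hinv F) y].

(* Main.v *)
Require Import Defs.
From mathcomp Require Import all_boot all_order all_algebra.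
From mathcomp Require Import all_classical all_reals all_analysis.
From mathcomp Require Import complex.
From mathcomp Require Import ring lra zify.
From Stdlib Require Import -(notations) Setoid Morphisms.

Import Order.TTheory GRing.Theory Num.Theory.
Import numFieldNormedType.Exports.

Local Open Scope classical_set_scope.
Local Open Scope ring_scope.

Set Implicit Arguments.
Unset Strict Implicit.
Unset Printing Implicit Defensive.

(** Let A x be the differential of f at a point x of L.  Since f is the identity on
    L, differentiating h f = f^n h at x shows that A x is conjugate, by the
    differential of h at x, to A (h x) ^ n.  This relation, together with
    bounds on the differentials over the compact set L, gives everything.

    Some power A x ^ N is unipotent, with N independent of x
    ([unipotent_power]).  If A x - 1 is invertible at some x in L, then x is an
    isolated fixed point of f ([isolated_fixed_point]), hence an isolated point
    of L; as L is minimal, x is recurrent, so L is a periodic orbit of h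
    ([isolated_periodic]), of period p say, and A y is conjugate to
    A y ^ (n ^ p) for all y in L.  The spectrum of A y, which has at most two
    elements, is then stable under l |-> l ^ (n ^ p), and consists of roots of
    unity of bounded order ([conj_power_unipotent]).  Otherwise 1 is an
    eigenvalue of every A x, and the other one, a, is real; going backwards
    along the orbit of x, a ^ (n ^ k) is an eigenvalue of A (h^-k x), whose
    size and that of its inverse are bounded independently of k, so a is 1 or -1
    ([eigenvalue_norm1]).

    The map fe = h^-k f^N h^k is an n^k-th root of f^N.  On L its differential
    is conjugate to A (h^k x) ^ N, so it has the form 1 + U with U^2 = 0, and its
    power 1 + n^k U is the differential of f^N: on L, the differential of fe is
    n^k times closer to the identity than that of f^N ([root_differential]).  For k
    large it is as close as desired, uniformly on L, and remains so on a
    neighborhood of L ([root_close]), which contains a ball B_delta(L) because the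
    Riemannian distance dominates the ambient one ([norm_le_sdist]) and L is
    compact.

    Replacing b by a^-k b^N a^k defines an injective endomorphism of BS(1,n),
    because in the affine action b : x |-> x + 1, a : x |-> n x, which is faithful
    ([affine_faithful]), it amounts to conjugating by a homothety
    ([BS_eq_subst_inj]).  Hence fe and h generate a faithful action.

    Differentials are handled as two by two matrices, in frames of the
    tangent planes given by arbitrary charts ([dmx]).  These frames need not vary
    continuously with the point: conjugacy classes do not depend on them, and
    all estimates are stated on tangent vectors. *)

(** * Words in the generators of BS(1,n) *)

#[local] Hint Resolve BS_eq_refl : core.

Add Parametric Relation n : BS_word (BS_eq n)
  reflexivity proved by (@BS_eq_refl n)
  symmetry proved by (@BS_eq_sym n)
  transitivity proved by (@BS_eq_trans n) as BS_eq_setoid.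

Add Parametric Morphism n : (@cat (BS_gen * bool)) with signature
  respectful (BS_eq n) (respectful (BS_eq n) (BS_eq n)) as BS_eq_cat_morphism.
Proof. by move=> ? ? ? ? ? ?; exact: BS_eq_cat. Qed.

Local Notation "w ^^ m" := (flatten (nseq m w)) (at level 30, right associativity).

Definition la : BS_word := [:: (BS_a, false)].
Definition la' : BS_word := [:: (BS_a, true)].
Definition lb : BS_word := [:: (BS_b, false)].
Definition lb' : BS_word := [:: (BS_b, true)].

Section Words.
Context {n : nat}.
Local Notation "u ~ v" := (BS_eq n u v) (at level 70).
Implicit Types u v w : BS_word.

Lemma powS w m : w ^^ m.+1 = w ++ w ^^ m. Proof. by []. Qed.

Lemma powD w p m : w ^^ (p + m) = w ^^ p ++ w ^^ m.
Proof. by rewrite nseqD flatten_cat. Qed.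

Lemma pow_nseq (l : BS_gen * bool) m : [:: l] ^^ m = nseq m l.
Proof. by elim: m => //= m ->. Qed.

Lemma powSr w m : w ^^ m.+1 = w ^^ m ++ w.
Proof. by rewrite -addn1 powD /= cats0. Qed.

Lemma aK : la ++ la' ~ [::]. Proof. exact: BS_eq_inv. Qed.
Lemma a'K : la' ++ la ~ [::]. Proof. exact: BS_eq_inv. Qed.
Lemma bK : lb ++ lb' ~ [::]. Proof. exact: BS_eq_inv. Qed.
Lemma b'K : lb' ++ lb ~ [::]. Proof. exact: BS_eq_inv. Qed.

Lemma powK u v m : u ++ v ~ [::] -> u ^^ m ++ v ^^ m ~ [::].
Proof.
move=> uv; elim: m => // m IH.
rewrite powSr powS -catA (catA u) uv; exact: IH.
Qed.

Lemma commute_pow u v m : u ++ v ~ v ++ u -> u ++ v ^^ m ~ v ^^ m ++ u.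
Proof.
move=> uv; elim: m => [|m IH]; first by rewrite cats0.
by rewrite powS catA uv -catA IH catA.
Qed.

Lemma pow_comm p r : lb' ^^ p ++ lb ^^ r ~ lb ^^ r ++ lb' ^^ p.
Proof.
apply: commute_pow; symmetry; apply: commute_pow.
by rewrite bK b'K.
Qed.

Lemma bb'_pow r s r' s' : (r + s' = r' + s)%N ->
  lb ^^ r ++ lb' ^^ s ~ lb ^^ r' ++ lb' ^^ s'.
Proof.
have aux m r0 s0 : lb ^^ (r0 + m) ++ lb' ^^ (m + s0) ~ lb ^^ r0 ++ lb' ^^ s0.
  by rewrite !powD -catA (catA (lb ^^ m)) powK ?bK.
move=> e; have [le|le] := leqP r r'.
  have -> : r' = (r + (r' - r))%N by lia.
  have -> : s' = ((r' - r) + s)%N by lia.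
  by rewrite aux.
have -> : r = (r' + (r - r'))%N by lia.
have -> : s = ((r - r') + s')%N by lia.
by rewrite aux.
Qed.

Lemma aba' : la ++ lb ++ la' ~ lb ^^ n.
Proof. by rewrite pow_nseq; exact: BS_eq_rel. Qed.

Lemma ab : la ++ lb ~ lb ^^ n ++ la.
Proof. by rewrite -aba' -!catA a'K cats0. Qed.

Lemma ab' : la ++ lb' ~ lb' ^^ n ++ la.
Proof.
have e : lb ^^ n ++ (la ++ lb') ~ la.
  by rewrite catA -ab -catA bK cats0.
by rewrite -{2}e catA powK ?b'K.
Qed.

Lemma ab_pow r : la ++ lb ^^ r ~ lb ^^ (n * r) ++ la.
Proof.
elim: r => [|r IH]; first by rewrite muln0 cats0.
by rewrite powS catA ab -catA IH catA mulnS powD.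
Qed.

Lemma ab'_pow r : la ++ lb' ^^ r ~ lb' ^^ (n * r) ++ la.
Proof.
elim: r => [|r IH]; first by rewrite muln0 cats0.
by rewrite powS catA ab' -catA IH catA mulnS powD.
Qed.

Lemma apow_b i r : la ^^ i ++ lb ^^ r ~ lb ^^ (n ^ i * r) ++ la ^^ i.
Proof.
elim: i => [|i IH]; first by rewrite expn0 mul1n cats0.
by rewrite powS -catA IH catA ab_pow -catA expnS mulnA.
Qed.

Lemma apow_b' i r : la ^^ i ++ lb' ^^ r ~ lb' ^^ (n ^ i * r) ++ la ^^ i.
Proof.
elim: i => [|i IH]; first by rewrite expn0 mul1n cats0.
by rewrite powS -catA IH catA ab'_pow -catA expnS mulnA.
Qed.

Lemma b_a'pow i r : lb ^^ r ++ la' ^^ i ~ la' ^^ i ++ lb ^^ (n ^ i * r).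
Proof.
have e : la' ^^ i ++ (la ^^ i ++ lb ^^ r) ++ la' ^^ i ~ lb ^^ r ++ la' ^^ i.
  by rewrite !catA powK ?a'K.
by rewrite -e apow_b -!catA powK ?aK // cats0.
Qed.

Lemma b'_a'pow i r : lb' ^^ r ++ la' ^^ i ~ la' ^^ i ++ lb' ^^ (n ^ i * r).
Proof.
have e : la' ^^ i ++ (la ^^ i ++ lb' ^^ r) ++ la' ^^ i ~ lb' ^^ r ++ la' ^^ i.
  by rewrite !catA powK ?a'K.
by rewrite -e apow_b' -!catA powK ?aK // cats0.
Qed.

(** The element a^-i b^(r-s) a^j; the pair r, s of natural numbers stands for the
    integer r - s. *)
Definition nf i r s j := la' ^^ i ++ (lb ^^ r ++ lb' ^^ s) ++ la ^^ j.

(** The relations a b^m = b^(n m) a and b^m a^-1 = a^-1 b^(n m) bring the letters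
    a^-1 to the left and the letters a to the right. *)
Lemma nf_exists w : exists i r s j, w ~ nf i r s j.
Proof.
elim: w => [|[g e] w [i [r [s [j IH]]]]].
  by exists 0, 0, 0, 0.
have e' : (g, e) :: w ~ [:: (g, e)] ++ nf i r s j.
  by rewrite -IH.
case: g e e' => -[] e'.
- by exists i.+1, r, s, j; rewrite e' /nf powS.
- case: i {IH} e' => [|i] e'.
    exists 0, (n * r)%N, (n * s)%N, j.+1; rewrite e' /nf.
    change (la ++ (lb ^^ r ++ lb' ^^ s) ++ la ^^ j ~
      (lb ^^ (n * r) ++ lb' ^^ (n * s)) ++ la ^^ j.+1).
    by rewrite powS !catA ab_pow -(catA _ la) ab'_pow !catA.
  exists i, r, s, j; rewrite e' /nf powS -/la !catA aK.
  by rewrite /= ?catA.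
- exists i, r, (n ^ i + s)%N, j; rewrite e' /nf.
  have e : lb' ++ la' ^^ i ~ la' ^^ i ++ lb' ^^ (n ^ i).
    by have := b'_a'pow i 1; rewrite muln1.
  by rewrite catA e -!catA (catA _ (lb ^^ r)) pow_comm powD -!catA.
- exists i, (n ^ i + r)%N, s, j; rewrite e' /nf.
  have e : lb ++ la' ^^ i ~ la' ^^ i ++ lb ^^ (n ^ i).
    by have := b_a'pow i 1; rewrite muln1.
  by rewrite catA e powD -!catA.
Qed.

(** Because a^-t b^(n^t m) a^t = b^m. *)
Lemma nf_shift t i r s j r' s' : (r' + n ^ t * s = n ^ t * r + s')%N ->
  nf (i + t) r' s' (t + j) ~ nf i r s j.
Proof.
move=> e; rewrite /nf !powD.
have -> : lb ^^ r' ++ lb' ^^ s' ~ lb ^^ (n ^ t * r) ++ lb' ^^ (n ^ t * s).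
  exact: bb'_pow.
rewrite -!catA (catA (la' ^^ t)) -b_a'pow -!catA.
by rewrite (catA (la' ^^ t)) -b'_a'pow -!catA (catA (la' ^^ t)) (powK _ a'K).
Qed.

End Words.

(** * Actions of BS(1,n) *)

Section HomeoActions.
Context {T : topologicalType}.
Implicit Types f h : homeo T.

Lemma word_act_cat f h u v :
  word_act f h (u ++ v) = word_act f h u \o word_act f h v.
Proof. by elim: u => //= l u ->. Qed.

Lemma word_act_pow f h w m :
  word_act f h (w ^^ m) = iter m (word_act f h w).
Proof. by elim: m => // m IH; rewrite powS word_act_cat IH. Qed.

Lemma BS_eq_act n f h w w' : BS_action n f h ->
  BS_eq n w w' -> word_act f h w = word_act f h w'.
Proof.
move=> act; elim=> {w w'} //.
- by move=> w1 w2 w3 _ -> _ ->.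
- by move=> w1 w1' w2 w2' _ e1 _ e2; rewrite !word_act_cat e1 e2.
- by case=> -[]; apply/funext => x /=; rewrite ?hfunK ?hinvK.
- rewrite -pow_nseq word_act_pow; exact: act.
Qed.

(** The substitution of w for b, where w' stands for the inverse of w. *)
Definition subst_b (w : BS_word) (w' : BS_word) : BS_word -> BS_word :=
  flatten \o map (fun l => match l with
    | (BS_b, false) => w | (BS_b, true) => w' | _ => [:: l] end).

Lemma word_act_subst f h (fe : homeo T) u u' :
  word_act f h u = fe -> word_act f h u' = hinv fe ->
  forall w, word_act f h (subst_b u u' w) = word_act fe h w.
Proof.
move=> eu eu'; elim=> // -[[] []] w /=; rewrite /subst_b /= => e;
  by rewrite ?word_act_cat ?eu ?eu' -?e.
Qed.

End HomeoActions.

Section AffineModel.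
Context {R : realType} (n : nat) (n2 : (2 <= n)%N).

Lemma n_neq0 : n%:R != 0 :> R. Proof. by rewrite pnatr_eq0; lia. Qed.

Lemma translationK : cancel (fun x : R => x + 1) (fun x => x - 1).
Proof. by move=> x; rewrite addrK. Qed.
Lemma translationVK : cancel (fun x : R => x - 1) (fun x => x + 1).
Proof. by move=> x; rewrite subrK. Qed.
Lemma scalingK : cancel (fun x : R => x * n%:R) (fun x => x / n%:R).
Proof. by move=> x; rewrite mulfK // n_neq0. Qed.
Lemma scalingVK : cancel (fun x : R => x / n%:R) (fun x => x * n%:R).
Proof. by move=> x; rewrite divfK // n_neq0. Qed.

Definition translation : homeo R.
Proof.
refine (@Homeo R _ _ translationK translationVK _ _) => x;
  apply: cvgD; [exact: cvg_id|exact: cvg_cst|exact: cvg_id|exact: cvg_cst].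
Defined.

Definition scaling : homeo R.
Proof.
by refine (@Homeo R _ _ scalingK scalingVK _ _) => x; exact: mulrr_continuous.
Defined.

Local Notation aff := (word_act translation scaling).

Lemma iter_translation m x : iter m translation x = x + m%:R.
Proof.
elim: m => [|m IH]; first by rewrite addr0.
by rewrite iterS IH /= -addrA natr1.
Qed.

Lemma aff_pow_b m x : aff (lb ^^ m) x = x + m%:R.
Proof. by rewrite word_act_pow iter_translation. Qed.

Lemma aff_pow_b' m x : aff (lb' ^^ m) x = x - m%:R.
Proof.
rewrite word_act_pow; elim: m => [|m IH]; first by rewrite subr0.
by rewrite iterS IH /= -addrA -opprD natr1.
Qed.

Lemma aff_pow_a m x : aff (la ^^ m) x = x * n%:R ^+ m.
Proof.
rewrite word_act_pow; elim: m => [|m IH]; first by rewrite mulr1.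
by rewrite iterS IH /= -mulrA exprSr.
Qed.

Lemma aff_pow_a' m x : aff (la' ^^ m) x = x / n%:R ^+ m.
Proof.
rewrite word_act_pow; elim: m => [|m IH]; first by rewrite expr0 divr1.
by rewrite iterS IH /= exprSr invfM mulrA.
Qed.

Lemma aff_nf i r s j x :
  aff (nf i r s j) x = (x * n%:R ^+ j + r%:R - s%:R) / n%:R ^+ i.
Proof.
rewrite /nf !word_act_cat /= aff_pow_a' aff_pow_b aff_pow_b' aff_pow_a.
by congr (_ / _); ring.
Qed.

Lemma affine_action : BS_action n translation scaling.
Proof.
apply/funext => x; rewrite iter_translation /=.
by rewrite mulrDl divfK ?n_neq0 // mul1r.
Qed.

(** A normal form a^-i b^(r-s) a^j acts by x |-> n^(j-i) x + (r-s)/n^i, and these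
    two coefficients determine it up to [nf_shift]. *)
Lemma affine_faithful : faithful_BS_action n translation scaling.
Proof.
split; first exact: affine_action.
suff main i r s j i' r' s' j' : (i <= i')%N ->
    aff (nf i r s j) = aff (nf i' r' s' j') ->
    BS_eq n (nf i r s j) (nf i' r' s' j').
  move=> w w' e.
  have [i [r [s [j ew]]]] := @nf_exists n w.
  have [i' [r' [s' [j' ew']]]] := @nf_exists n w'.
  rewrite ew ew'.
  have {e} : aff (nf i r s j) = aff (nf i' r' s' j').
    by rewrite -(BS_eq_act affine_action ew) -(BS_eq_act affine_action ew').
  have [le|/ltnW le] := leqP i i'; first exact: main.
  by move=> e; symmetry; apply: main.
move=> le e.
have nX k : n%:R ^+ k != 0 :> R by rewrite expf_neq0 // n_neq0.
have e0 : r%:R - s%:R = (r'%:R - s'%:R) / n%:R ^+ (i' - i) :> R.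
  have := congr1 (@^~ 0) e; rewrite !aff_nf !mul0r !add0r.
  rewrite -{1}(subnK le) exprD invfM mulrA => /(mulIf _); apply.
  by rewrite invr_eq0.
have e1 : n%:R ^+ j = n%:R ^+ j' / n%:R ^+ (i' - i) :> R.
  have := congr1 (@^~ 1) e; rewrite !aff_nf !mul1r -!addrA.
  rewrite -{1}(subnK le) exprD invfM mulrA => /(mulIf _).
  rewrite invr_eq0 => /(_ (nX _)).
  by rewrite [in RHS]mulrDl e0 => /addIr.
have {e1} -> : j' = (i' - i + j)%N.
  move: e1 => /(congr1 (fun y => y * n%:R ^+ (i' - i))).
  rewrite divfK // -exprD -!natrX => /eqP.
  by rewrite eqr_nat eqn_exp2l // addnC => /eqP <-.
rewrite -{1}(subnKC le); symmetry; apply: nf_shift.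
move: e0 => /(congr1 (fun y => y * n%:R ^+ (i' - i))).
rewrite divfK // -!natrX mulrBl -!natrM => e0.
apply/eqP; rewrite -(eqr_nat R) !natrD; apply/eqP.
by rewrite ![(n ^ _ * _)%N]mulnC; lra.
Qed.

End AffineModel.

(** Substituting b := a^-k b^N a^k amounts, in the affine model, to conjugating
    by the homothety of ratio N / n^k; this is why it is injective in BS(1,n). *)
Lemma BS_eq_subst_inj (R : realType) n N k w w' : (2 <= n)%N -> (0 < N)%N ->
  let s := subst_b (la' ^^ k ++ lb ^^ N ++ la ^^ k)
                   (la' ^^ k ++ lb' ^^ N ++ la ^^ k) in
  BS_eq n (s w) (s w') -> BS_eq n w w'.
Proof.
move=> n2 N0 s /(BS_eq_act (affine_action (R := R) n2)) e.
apply: (affine_faithful (R := R) n2).2.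
pose c : R := N%:R / n%:R ^+ k.
have nk0 : n%:R ^+ k != 0 :> R by rewrite expf_neq0 // n_neq0.
have c0 : c != 0 by rewrite mulf_neq0 ?invr_eq0 // pnatr_eq0; lia.
have conj u x : word_act (translation (R:=R)) (scaling n2) (s u) (c * x) =
    c * word_act (translation (R:=R)) (scaling n2) u x.
  elim: u => // l u; 
  have -> : s (l :: u) = s [:: l] ++ s u by rewrite /s /subst_b /= cats0.
  rewrite word_act_cat /=.
  move=> ->; move: (word_act _ _ u x) => y.
  case: l => -[] [] /=; rewrite /s /subst_b /= ?mulrA // cats0.
    rewrite !word_act_cat /= aff_pow_a' aff_pow_b' aff_pow_a.
    by rewrite mulrBl mulfK // mulrBr mulr1.
  rewrite !word_act_cat /= aff_pow_a' aff_pow_b aff_pow_a.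
  by rewrite mulrDl mulfK // mulrDr mulr1.
apply/funext => x; apply: (mulfI c0); by rewrite -!conj e.
Qed.

Section Roots.
Context {T : topologicalType}.
Implicit Types f h : homeo T.

Lemma iterK (g g' : T -> T) k : cancel g g' -> cancel (iter k g) (iter k g').
Proof.
by move=> gK; elim: k => // k IH x; rewrite iterSr iterS /= gK IH.
Qed.

Lemma iter_continuous (g : T -> T) k : continuous g -> continuous (iter k g).
Proof.
move=> cg; elim: k => [|k IH] x; first exact: cvg_id.
by apply: (@continuous_comp _ _ _ (iter k g) g); [exact: IH|exact: cg].
Qed.

(** An n^k-th root of f^N, since h^k f^N h^-k = (f^N)^(n^k). *)
Definition conj_root f h (N k : nat) : homeo T.
Proof.
refine (@Homeo T (iter k (hinv h) \o iter N f \o iter k h)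
  (iter k (hinv h) \o iter N (hinv f) \o iter k h) _ _ _ _).
- move=> x /=; rewrite (iterK _ (hinvK h)) (iterK _ (hfunK f)).
  by rewrite (iterK _ (hfunK h)).
- move=> x /=; rewrite (iterK _ (hinvK h)) (iterK _ (hinvK f)).
  by rewrite (iterK _ (hfunK h)).
- move=> x; apply: continuous_comp; first exact/iter_continuous/hfun_continuous.
  apply: continuous_comp; apply/iter_continuous;
    [exact: hfun_continuous|exact: hinv_continuous].
- move=> x; apply: continuous_comp; first exact/iter_continuous/hfun_continuous.
  apply: continuous_comp; apply/iter_continuous; exact: hinv_continuous.
Defined.

Lemma conj_rootE f h N k :
  word_act f h (la' ^^ k ++ lb ^^ N ++ la ^^ k) = conj_root f h N k.
Proof. by rewrite !word_act_cat !word_act_pow. Qed.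

Lemma conj_rootVE f h N k :
  word_act f h (la' ^^ k ++ lb' ^^ N ++ la ^^ k) = hinv (conj_root f h N k).
Proof. by rewrite !word_act_cat !word_act_pow. Qed.

Lemma conj_root_iter f h N k m :
  iter m (conj_root f h N k) = conj_root f h (N * m) k.
Proof.
elim: m => [|m IH]; apply/funext => x.
  by rewrite muln0 /= (iterK _ (hfunK h)).
by rewrite iterS IH /= (iterK _ (hinvK h)) mulnS iterD.
Qed.

Context {n : nat} {f h : homeo T} (act : BS_action n f h).

Lemma action_iter m : h \o iter m f = iter (n * m) f \o h.
Proof.
have hf x : h (f x) = iter n f (h x) by rewrite -act /= hfunK.
elim: m => [|m IH]; apply/funext => x /=; first by rewrite muln0.
by rewrite hf mulnS iterD -[h _]/((h \o iter m f) x) IH.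
Qed.

Lemma iter_action k m :
  iter k h \o iter m f = iter (m * n ^ k) f \o iter k h.
Proof.
elim: k m => [|k IH] m; first by rewrite muln1.
apply/funext => x; rewrite /= -[iter k h _]/((iter k h \o iter m f) x) IH /=.
rewrite -[h _]/((h \o iter (m * n ^ k) f) (iter k h x)) action_iter /=.
by congr (iter _ f _); rewrite expnS; lia.
Qed.

Lemma iter_conj_root N k : iter (n ^ k) (conj_root f h N k) = iter N f.
Proof.
rewrite conj_root_iter /= -compA -iter_action.
by apply/funext => x /=; rewrite (iterK _ (hfunK h)).
Qed.

Lemma conj_root_action N k : BS_action n (conj_root f h N k) h.
Proof.
rewrite /BS_action conj_root_iter; apply/funext => x.
apply: (can_inj (hinvK h)).
rewrite /= hfunK.
have e g : iter k (hinv h) (hinv h g) = hinv h (iter k (hinv h) g).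
  by rewrite -iterSr.
rewrite -e; congr iter; apply: (can_inj (hfunK h)).
by rewrite hinvK -[h _]/((h \o iter N f) (iter k h (hinv h x))) action_iter /=
  -iterS iterSr hinvK mulnC.
Qed.

End Roots.

Lemma conj_root_faithful (R : realType) (T : topologicalType) n (f h : homeo T)
    N k : (2 <= n)%N -> (0 < N)%N ->
  faithful_BS_action n f h -> faithful_BS_action n (conj_root f h N k) h.
Proof.
move=> n2 N0 [act faith]; split; first exact: conj_root_action.
move=> w w'; rewrite -!(word_act_subst (conj_rootE f h N k) (conj_rootVE f h N k)).
by move/faith/(BS_eq_subst_inj R); apply.
Qed.

(** * Eigenvalues and unipotent powers of matrices *)

Section Matrices.
Context {F : fieldType} {m : nat}.
Implicit Types (A B U : 'M[F]_m.+1) (a b : F).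

Lemma eigenvalue_exp A a k : eigenvalue A a -> eigenvalue (A ^+ k) (a ^+ k).
Proof.
move=> /eigenvalueP[v vA v0]; apply/eigenvalueP; exists v => //.
elim: k => [|k IH]; first by rewrite !expr0 mulmx1 scale1r.
by rewrite exprS [v *m _]mulmxA vA -scalemxAl IH scalerA -exprS.
Qed.

Lemma eigenvalue_conj A B H a : H \in unitmx -> H *m B = A *m H ->
  eigenvalue A a = eigenvalue B a.
Proof.
suff main P A' B' : P \in unitmx -> P *m B' = A' *m P ->
    eigenvalue B' a -> eigenvalue A' a.
  move=> uH e; apply/idP/idP; last exact: main e.
  apply: (main (invmx H)); first by rewrite unitmx_inv.
  by rewrite -[B]mul1mx -(mulVmx uH) -(mulmxA _ H) e -!mulmxA mulmxV // mulmx1.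
move=> uH e /eigenvalueP[v vB v0]; apply/eigenvalueP; exists (v *m invmx P).
  have -> : A' = P *m B' *m invmx P by rewrite e -mulmxA mulmxV // mulmx1.
  by rewrite !mulmxA mulmxKV // vB scalemxAl.
apply: contra v0 => /eqP e0; apply/eqP.
by rewrite -[v]mulmx1 -(mulVmx uH) mulmxA e0 mul0mx.
Qed.

Lemma eigenvalue_cases A a b l : (A - a%:M) * (A - b%:M) = 0 ->
  eigenvalue A l -> l = a \/ l = b.
Proof.
move=> AB /eigenvalueP[v vA v0].
have vAc c : v *m (A - c%:M) = (l - c) *: v.
  by rewrite mulmxBr vA mul_mx_scalar scalerBl.
have : v *m (A - a%:M) *m (A - b%:M) = 0.
  by rewrite -mulmxA [X in v *m X]AB mulmx0.
rewrite vAc -scalemxAl vAc scalerA => /eqP.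
rewrite scaler_eq0 (negPf v0) orbF mulf_eq0.
by rewrite !subr_eq0 => /orP[] /eqP; [left|right].
Qed.

(** X^N - 1 is a multiple of X - a and of X - b, so its square is a multiple of
    (X - a) (X - b). *)
Lemma unipotent_exp A a b N : (A - a%:M) * (A - b%:M) = 0 ->
  a ^+ N = 1 -> b ^+ N = 1 -> (A ^+ N - 1) ^+ 2 = 0.
Proof.
move=> AB aN bN.
have dvd c : c ^+ N = 1 -> 'X - c%:P %| ('X^N - 1 : {poly F}).
  move=> cN; rewrite dvdp_XsubCl rootE !hornerE ?hornerXn cN.
  by rewrite subrr.
have /dvdpP[q e] := dvdp_mul (dvd _ aN) (dvd _ bN).
have := congr1 (horner_mx A) e.
rewrite -expr2 rmorphXn /= rmorphB /= rmorphXn /= horner_mx_X rmorph1 => ->.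
by rewrite !rmorphM !rmorphB /= horner_mx_X !horner_mx_C AB mulr0.
Qed.

Lemma expr1D_nilpotent U k : U ^+ 2 = 0 -> (1 + U) ^+ k = 1 + U *+ k.
Proof.
move=> U2; elim: k => [|k IH]; first by rewrite expr0 mulr0n addr0.
rewrite exprS IH mulrDl mul1r mulrDr mulr1 mulrnAr -expr2 U2 mul0rn addr0.
by rewrite -addrA -mulrSr.
Qed.

Lemma eigenvalue_inverse A B a :
  A *m B = 1%:M -> eigenvalue A a -> eigenvalue B a^-1.
Proof.
move=> AB /eigenvalueP [v vA v0]; apply/eigenvalueP; exists v => //.
have e : a *: (v *m B) = v by rewrite scalemxAl -vA -mulmxA AB mulmx1.
have a0 : a != 0.
  by apply: contra v0 => /eqP a0; rewrite -e a0 scale0r.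
by rewrite -[in RHS]e scalerA mulVf // scale1r.
Qed.

Lemma conj_unipotent (P P' M : 'M[F]_m.+1) :
  P *m P' = 1%:M -> (M - 1) ^+ 2 = 0 -> (P *m M *m P' - 1) ^+ 2 = 0.
Proof.
move=> PP' M2; have P'P := mulmx1C PP'.
have -> : P *m M *m P' - 1 = P *m (M - 1) *m P'.
  by rewrite mulmxBr mulmxBl mulmx1 PP'.
move: (M - 1) M2 => U; rewrite !expr2 => U2.
have mulE (X Y : 'M[F]_m.+1) : X * Y = X *m Y by [].
rewrite !mulE in U2 *.
by rewrite !mulmxA -(mulmxA (P *m U) P' P) P'P mulmx1 -(mulmxA P) U2 mulmx0 mul0mx.
Qed.

Lemma unipotent_eigenvalue A l : (A - 1) ^+ 2 = 0 -> (eigenvalue A l <-> l = 1).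
Proof.
move=> A2; split=> [el|->].
  by have := @eigenvalue_cases A 1 1 l; case => //; rewrite -expr2.
have : \det (A - 1) = 0.
  apply/eqP; rewrite -[_ == 0]orbb -mulf_eq0 -det_mulmx.
  have -> : (A - 1) *m (A - 1) = 0 by exact: A2.
  by rewrite det0.
move/eqP/det0P => [v v0 vA]; apply/eigenvalueP; exists v => //.
by apply/eqP; rewrite scale1r -subr_eq0 -{2}[v]mulmx1 -mulmxBr vA.
Qed.

End Matrices.

Section Matrices2.
Context {F : fieldType}.
Implicit Types (A B U : 'M[F]_2) (a b : F).

Lemma second_eigenvalue A a : eigenvalue A a ->
  exists2 b, eigenvalue A b & (A - a%:M) * (A - b%:M) = 0.
Proof.
rewrite eigenvalue_root_char => /factor_theorem[q e].
have mp := char_poly_monic A.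
have mq : q \is monic by move: mp; rewrite e monicMr // monicXsubC.
have sq : size q = 2.
  have := size_char_poly A; rewrite e size_Mmonic ?monic_neq0 ?monicXsubC //.
  by rewrite size_XsubC addn2 => -[].
have qE : q = 'X - (- q`_0)%:P.
  apply/polyP => -[|[|i]]; rewrite coefB coefX coefC /= ?sub0r ?subr0 ?opprK //.
    by move: mq; rewrite monicE /lead_coef sq /= => /eqP.
  by rewrite oppr0 nth_default ?sq.
exists (- q`_0).
  by rewrite eigenvalue_root_char e rootM {1}qE root_XsubC eqxx.
have := Cayley_Hamilton A; rewrite e mulrC rmorphM /= {1}qE !rmorphB /=.
by rewrite horner_mx_X !horner_mx_C.
Qed.

(** The powers l, l^q and l^(q^2) of an eigenvalue l of A are eigenvalues of A,
    and A has at most two. *)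
Lemma conj_power_unipotent A H q : (2 <= q)%N ->
  A \in unitmx -> H \in unitmx -> H *m A ^+ q = A *m H ->
  (exists a, eigenvalue A a) -> (A ^+ (q * (q ^ 2 - 1)) - 1) ^+ 2 = 0.
Proof.
move=> q2 uA uH e [a ea].
have [b eb AB] := second_eigenvalue ea.
suff key l : eigenvalue A l -> l ^+ (q * (q ^ 2 - 1)) = 1.
  by apply: (unipotent_exp AB); apply: key.
have pow c : eigenvalue A c -> eigenvalue A (c ^+ q).
  by move=> ec; rewrite (eigenvalue_conj _ uH e) eigenvalue_exp.
move=> el; have el1 := pow _ el; have el2 := pow _ el1.
have l0 : l != 0.
  apply: contraTneq el => ->; apply/eigenvalueP => -[v].
  rewrite scale0r => vA; rewrite -[v]mulmx1 -(mulmxV uA) mulmxA vA mul0mx.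
  by rewrite eqxx.
have cancelX i j : (i <= j)%N -> l ^+ i = l ^+ j -> l ^+ (j - i) = 1.
  move=> ij elx; apply: (mulfI (expf_neq0 i l0)).
  by rewrite -exprD subnKC // mulr1.
have dv d k : l ^+ d = 1 -> l ^+ (d * k) = 1 by move=> ld; rewrite exprM ld expr1n.
rewrite -exprM in el2.
have c1 : l = l ^+ q -> l ^+ (q * (q ^ 2 - 1)) = 1.
  move=> /(cancelX 1%N q (ltnW q2)) /dv h.
  have -> : (q * (q ^ 2 - 1) = (q - 1) * (q * (q + 1)))%N by nia.
  exact: h.
have c2 : l ^+ q = l ^+ (q * q) -> l ^+ (q * (q ^ 2 - 1)) = 1.
  move=> /(cancelX q (q * q)%N) /=; rewrite leq_pmulr; last by lia.
  move=> /(_ isT) /dv h.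
  have -> : (q * (q ^ 2 - 1) = (q * q - q) * (q + 1))%N by nia.
  exact: h.
have c3 : l = l ^+ (q * q) -> l ^+ (q * (q ^ 2 - 1)) = 1.
  move=> /(cancelX 1%N (q * q)%N) /=; rewrite muln_gt0; have -> : (0 < q)%N by lia.
  move=> /(_ isT) /dv h; rewrite mulnC -mulnn; exact: h.
have [E|E] := eigenvalue_cases AB el; have [E1|E1] := eigenvalue_cases AB el1;
  have [E2|E2] := eigenvalue_cases AB el2; solve
  [apply: c1; congruence|apply: c2; congruence|apply: c3; congruence].
Qed.

End Matrices2.

Lemma exists_eigenvalue (F : closedFieldType) m (A : 'M[F]_m.+1) :
  exists a, eigenvalue A a.
Proof.
have [|a ra] := closed_rootP (char_poly A) _; first by rewrite size_char_poly.
by exists a; rewrite eigenvalue_root_char.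
Qed.

Lemma real_conj_power_unipotent (R : realType) (A H : 'M[R]_2) q : (2 <= q)%N ->
  A \in unitmx -> H \in unitmx -> H *m A ^+ q = A *m H ->
  (A ^+ (q * (q ^ 2 - 1)) - 1) ^+ 2 = 0.
Proof.
move=> q2 uA uH e; pose f := @map_mx _ _ (real_complex R) 2 2.
have fX B k : f (B ^+ k) = f B ^+ k by exact: rmorphXn.
apply: (@map_mx_inj _ _ (real_complex R)); rewrite -/(f _) fX.
rewrite [f (_ - _)]map_mxB -/(f _) fX map_mx1 map_mx0.
apply: (@conj_power_unipotent _ (f A) (f H)) => //; rewrite ?map_unitmx //.
  by rewrite -fX -!map_mxM e.
exact: exists_eigenvalue.
Qed.

(** * Dynamics on a minimal set *)

Section Minimal.
Context {T : topologicalType} {f h : homeo T} {L : set T}.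
Hypotheses (Lmin : minimal_set f h L) (Lf : L `<=` Fix f).

Lemma invariant_letters L' : (forall l x, L' x -> L' (letter_act f h l x)) ->
  invariant_set f h L'.
Proof.
move=> inv g [w _ <-] _ [x L'x <-]; elim: w => //= l w IH.
exact: inv.
Qed.

Lemma letter_inv l x : L x -> L (letter_act f h l x).
Proof.
case: Lmin => _ _ inv _ Lx.
by apply: (inv (word_act f h [:: l])); [exists [:: l]|exists x].
Qed.

Lemma h_inv x : L x -> L (h x).
Proof. exact: (letter_inv (BS_a, false)). Qed.

Lemma hV_inv x : L x -> L (hinv h x).
Proof. exact: (letter_inv (BS_a, true)). Qed.

Lemma fV_fix x : L x -> hinv f x = x.
Proof. by move=> Lx; rewrite -{1}(Lf Lx) hfunK. Qed.

Lemma iter_h_inv k x : L x -> L (iter k h x).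
Proof. by move=> Lx; elim: k => // k /h_inv. Qed.

Lemma iter_hV_inv k x : L x -> L (iter k (hinv h) x).
Proof. by move=> Lx; elim: k => // k /hV_inv. Qed.

(** Since f is the identity on L, minimality only involves h. *)
Lemma h_minimal L' : L' !=set0 -> compact L' -> L' `<=` L ->
  (forall x, L' x -> L' (h x)) -> (forall x, L' x -> L' (hinv h x)) -> L' = L.
Proof.
move=> ne co sub hL' hVL'; case: Lmin => _ _ _; apply => //.
apply: invariant_letters => -[[] []] x L'x /=; [exact: hVL'|exact: hL'|..].
  by rewrite fV_fix //; exact: sub.
by rewrite (Lf (sub _ L'x)).
Qed.

(** The omega-limit set of x meets L in a nonempty closed invariant set, hence
    contains x. *)
Lemma recurrent x O : L x -> nbhs x O -> exists2 p, (0 < p)%N & O (iter p h x).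
Proof.
move=> Lx Ox; case: (Lmin) => _ cL _ _.
pose F := (fun i => iter i h x) @ \oo.
have FL : F L by exists 0 => // i _; exact: iter_h_inv.
have E : L `&` cluster F = L.
  apply: h_minimal.
  - exact: cL.
  - apply: compact_closedI => //; rewrite clusterE.
    by apply: closed_bigI => ? _; exact: closed_closure.
  - by move=> ? [].
  - move=> y [Ly cy]; split; first exact: h_inv.
    move=> A B [i _ FA] nB; have := cy (h @^-1` A) (h @^-1` B).
    case.
    + by exists i => // j ij /=; apply: (FA j.+1); apply: leq_trans ij _.
    + exact: hfun_continuous.
    + by move=> z [Az Bz]; exists (h z).
  - move=> y [Ly cy]; split; first exact: hV_inv.
    move=> A B [i _ FA] nB; have := cy (hinv h @^-1` A) (hinv h @^-1` B).
    case.
    + by exists i.+1 => // -[//|j] ij /=; rewrite hfunK; apply: FA.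
    + exact: hinv_continuous.
    + by move=> z [Az Bz]; exists (hinv h z).
have [_ cx] : (L `&` cluster F) x by rewrite E.
have [||y [[p p0 <-] Oy]] := cx [set iter p h x | p in [set p | (0 < p)%N]] O.
- by exists 1%N => // p p0; exists p.
- exact: Ox.
- by exists p.
Qed.

(** An isolated point is equal to the points of its orbit that come back close to it;
    its orbit is then finite, so compact and invariant. *)
Lemma isolated_periodic x O : L x -> nbhs x O -> O `&` L `<=` [set x] ->
  exists2 p, (0 < p)%N & forall y, L y -> iter p h y = y.
Proof.
move=> Lx Ox iso; have [p p0 Op] := recurrent Lx Ox.
have px : iter p h x = x by apply: iso; split => //; exact: iter_h_inv.
have Q0 : [set iter i h x | i in `I_p] x by exists 0.
have <- : [set iter i h x | i in `I_p] = L.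
  apply: h_minimal.
  - by exists x.
  - by apply: finite_compact; apply/finite_image/finite_II.
  - by move=> _ [i _ <-]; exact: iter_h_inv.
  - move=> _ [i /= ip <-]; have [ip1|pi] := ltnP i.+1 p; first by exists i.+1.
    have e : i.+1 = p by apply/eqP; rewrite eqn_leq pi ip.
    by rewrite -iterS e px.
  - move=> _ [[|i] /= ip <-]; last by exists i; [exact: ltnW|rewrite /= hfunK].
    exists p.-1; first by rewrite /= prednK.
    by rewrite -[in RHS]px -{2}(prednK p0) /= hfunK.
exists p => // _ [i _ <-].
by rewrite -iterD addnC iterD px.
Qed.

End Minimal.

(** * Norms and limits of matrices *)

Section MatrixAnalysis.
Context {R : realType}.

Lemma mx_cvg (T : Type) (F : set_system T) {FF : Filter F} m k
    (M : T -> 'M[R]_(m, k)) (N : 'M[R]_(m, k)) :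
  (forall i j, (fun t => M t i j) @ F --> N i j) -> M @ F --> N.
Proof.
move=> cvg A [P PN sPA].
have : \forall t \near F, forall i j, P i j (M t i j).
  by apply: filter_forall => i; apply: filter_forall => j; exact: cvg (PN i j).
by apply: filterS => t Pt; exact: sPA.
Qed.

Lemma cvg_entry (T : Type) (F : set_system T) {FF : Filter F} m k
    (M : T -> 'M[R]_(m, k)) (N : 'M[R]_(m, k)) i j :
  M @ F --> N -> (fun t => M t i j) @ F --> N i j.
Proof.
move=> cM.
exact (@continuous_cvg T _ _ F FF M (fun N : 'M[R]_(m, k) => N i j) N
  (@coord_continuous _ _ _ i j N) cM).
Qed.

Lemma cvg_mulmx (T : Type) (F : set_system T) {FF : Filter F} m k l
    (A : T -> 'M[R]_(m, k)) (B : T -> 'M[R]_(k, l))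
    (A0 : 'M[R]_(m, k)) (B0 : 'M[R]_(k, l)) :
  A @ F --> A0 -> B @ F --> B0 -> (fun t => A t *m B t) @ F --> A0 *m B0.
Proof.
move=> cA cB; apply: mx_cvg => i j; rewrite mxE.
under eq_fun do rewrite mxE.
apply: cvg_big => [|s _]; first exact: add_continuous.
by apply: cvgM; exact: cvg_entry.
Qed.

Lemma mx_entry_le m k (A : 'M[R]_(m, k)) i j : `|A i j| <= `|A|.
Proof.
rewrite [`|A|]mx_normrE.
exact: (le_bigmax _ (fun ij => `|A ij.1 ij.2|) (i, j)).
Qed.

Lemma mx_norm_le m k (A : 'M[R]_(m, k)) e : 0 <= e ->
  (forall i j, `|A i j| <= e) -> `|A| <= e.
Proof.
by move=> e0 Ae; rewrite [`|A|]mx_normrE; apply: bigmax_le => // -[i j] _.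
Qed.

Lemma mulmx_norm_le m k l (A : 'M[R]_(m, k)) (B : 'M[R]_(k, l)) :
  `|A *m B| <= k%:R * `|A| * `|B|.
Proof.
apply: mx_norm_le => [|i j]; first by rewrite !mulr_ge0.
rewrite mxE; apply: le_trans (ler_norm_sum _ _ _) _.
apply: (@le_trans _ _ (\sum_(s < k) `|A| * `|B|)).
  by apply: ler_sum => s _; rewrite normrM ler_pM // mx_entry_le.
by rewrite sumr_const card_ord -[leLHS]mulr_natl mulrA.
Qed.

Lemma norm_lt_dist m k (A B : 'M[R]_(m, k)) e :
  `|A - B| < e -> `|B| < `|A| + e.
Proof.
move=> AB; have := ler_normB A (A - B); rewrite subKr => /le_lt_trans; apply.
by rewrite ltrD2l.
Qed.

Lemma norm_le_enorm k (v : 'rV[R]_k) : `|v| <= enorm v.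
Proof.
apply: mx_norm_le => [|i j]; first exact: sqrtr_ge0.
rewrite ord1 -sqrtr_sqr ler_sqrt; last first.
  by apply: sumr_ge0 => s _; rewrite -expr2 sqr_ge0.
rewrite /dot (bigD1 j) //= expr2 lerDl; apply: sumr_ge0 => s _.
by rewrite -expr2 sqr_ge0.
Qed.

Lemma enorm_le_norm (v : 'rV[R]_3) : enorm v <= 3 * `|v|.
Proof.
have v3 : 0 <= 3 * `|v| by rewrite mulr_ge0.
rewrite /enorm -[leRHS]ger0_norm // -sqrtr_sqr ler_sqrt ?sqr_ge0 //.
apply: (@le_trans _ _ (\sum_(i < 3) `|v| ^+ 2)).
  apply: ler_sum => i _; rewrite -expr2 -real_normK ?num_real //.
  by rewrite ler_sqr ?nnegrE // mx_entry_le.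
rewrite sumr_const card_ord -[leLHS]mulr_natl exprMn ler_wpM2r ?sqr_ge0 //.
by rewrite -natrX ler_nat.
Qed.

End MatrixAnalysis.

(** * Jacobian matrices *)

Section Jacobians.
Context {R : realType}.

Lemma diff_jacobian m k (g : 'rV[R]_m -> 'rV[R]_k) p v :
  'd g p v = v *m 'J g p.
Proof. by rewrite /jacobian mul_rV_lin1. Qed.

Lemma jacobian_comp m k l (f : 'rV[R]_m -> 'rV[R]_k) (g : 'rV[R]_k -> 'rV[R]_l) p :
  differentiable f p -> differentiable g (f p) ->
  'J (g \o f) p = 'J f p *m 'J g (f p).
Proof.
move=> df dg; apply/row_matrixP => i.
rewrite row_mul rowE -diff_jacobian (diff_comp df dg) /=.
by rewrite !diff_jacobian rowE.
Qed.

Lemma near_eq_jacobian m k (f g : 'rV[R]_m -> 'rV[R]_k) p :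
  differentiable f p -> differentiable g p -> {near p, f =1 g} -> 'J f p = 'J g p.
Proof.
move=> df dg fg; apply/row_matrixP => i.
rewrite [LHS]rowE [RHS]rowE -[LHS]diff_jacobian -[RHS]diff_jacobian.
set v := delta_mx 0 i.
exact (etrans (esym (deriveE v df)) (etrans (near_eq_derive v fg) (deriveE v dg))).
Qed.

Lemma jacobian_id m (p : 'rV[R]_m) : 'J id p = 1%:M.
Proof.
apply/row_matrixP => i; rewrite rowE -diff_jacobian.
by rewrite (diff_val (df := id)) row1.
Qed.

Definition C1_map m k (W : set 'rV[R]_m) (g : 'rV[R]_m -> 'rV[R]_k) :=
  (forall p, W p -> differentiable g p) /\
  (forall p, W p -> {for p, continuous (jacobian g)}).

Lemma derive_entry m k (g : 'rV[R]_m -> 'rV[R]_k) p i j :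
  differentiable g p -> 'J g p i j = 'D_(delta_mx 0 i) g p 0 j.
Proof. by move=> dg; rewrite deriveEjacobian // -rowE [RHS]mxE. Qed.

(** The rows of the Jacobian matrix are the derivatives along the canonical basis;
    conversely a directional derivative is linear in the Jacobian matrix. *)
Lemma C1_mapP m k (W : set 'rV[R]_m) (g : 'rV[R]_m -> 'rV[R]_k) :
  open W -> Ck_on 1 W g <-> C1_map W g.
Proof.
move=> oW; split=> -[dg cg]; (split; first exact: dg).
  move=> p Wp; suff cvg i j : 'J g q i j @[q --> p] --> 'J g p i j.
    exact (@mx_cvg _ _ (nbhs p) _ _ _ (jacobian g) (jacobian g p) cvg).
  have c : 'D_(delta_mx 0 i) g q 0 j @[q --> p] --> 'D_(delta_mx 0 i) g p 0 j.
    exact (@cvg_entry _ _ (nbhs p) _ _ _ _ _ 0 j (cg (delta_mx 0 i) p Wp)).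
  rewrite -(derive_entry i j (dg p Wp)) in c.
  have nr : \forall q \near p, 'D_(delta_mx 0 i) g q 0 j = 'J g q i j.
    near=> q; apply/esym/derive_entry/dg; near: q; exact: open_nbhs_nbhs.
  exact (cvg_trans (near_eq_cvg nr) c).
move=> v p Wp; have e q : W q -> 'D_v g q = v *m 'J g q.
  by move=> Wq; apply: deriveEjacobian; exact: dg.
have c : v *m 'J g q @[q --> p] --> v *m 'J g p.
  exact (@cvg_mulmx _ _ (nbhs p) _ _ _ _ _ _ _ _ (cvg_cst v) (cg p Wp)).
have nr : \forall q \near p, v *m 'J g q = 'D_v g q.
  by near=> q; rewrite e //; near: q; exact: open_nbhs_nbhs.
rewrite /prop_for /continuous_at (e p Wp).
exact (cvg_trans (near_eq_cvg nr) c).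
Unshelve. all: by end_near. Qed.

Lemma C1_map_comp m k l (W : set 'rV[R]_m) (W' : set 'rV[R]_k) f
    (g : 'rV[R]_k -> 'rV[R]_l) : open W -> open W' ->
  C1_map W f -> C1_map W' g -> C1_map (W `&` f @^-1` W') (g \o f).
Proof.
move=> oW oW' [df cf] [dg cg].
have cf0 p : W p -> {for p, continuous f}.
  by move=> Wp; exact/differentiable_continuous/df.
split=> p [Wp W'p]; first by apply: differentiable_comp; [exact: df|exact: dg].
have cgf : 'J g (f q) @[q --> p] --> 'J g (f p).
  exact (@continuous_cvg _ _ _ (nbhs p) _ f _ _ (cg (f p) W'p) (cf0 p Wp)).
have cM M : 'J f p *m 'J g (f p) = M -> 'J f q *m 'J g (f q) @[q --> p] --> M.
  move=> <-; exact (@cvg_mulmx _ _ (nbhs p) _ _ _ _ _ _ _ _ (cf p Wp) cgf).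
have c := cM _ (esym (jacobian_comp (df p Wp) (dg (f p) W'p))).
have nr : \forall q \near p, 'J f q *m 'J g (f q) = 'J (g \o f) q.
  near=> q; apply/esym/jacobian_comp; [apply: df|apply: dg]; near: q.
    exact: open_nbhs_nbhs.
  by apply: (cf0 p Wp); exact: open_nbhs_nbhs.
exact (cvg_trans (near_eq_cvg nr) c).
Unshelve. all: by end_near. Qed.

End Jacobians.

(** * The differential of a map of the surface, in frames of the tangent planes *)

Section Frames.
Context {R : realType} {S : closed_oriented_surface R}.
Implicit Types (F G : S -> S) (x y : S) (p q : 'rV[R]_3).

Lemma val_carrier x : carrier S (\val x).
Proof. by apply/set_mem; exact: valP. Qed.

Section Chart.
Context {U : set 'rV[R]_2} {W : set 'rV[R]_3} {phi : 'rV[R]_2 -> 'rV[R]_3}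
  {psi : 'rV[R]_3 -> 'rV[R]_2}.
Context (P : parametrization (carrier S) U W phi psi).

Lemma chart_inv p : carrier S p -> W p -> U (psi p) /\ phi (psi p) = p.
Proof.
move=> Sp Wp; have : (phi @` U) p by rewrite (param_image P).
by move=> [u Uu <-]; rewrite (param_K P).
Qed.

Lemma chart_image u : U u -> carrier S (phi u) /\ W (phi u).
Proof. by move=> Uu; rewrite -[_ /\ _]/((_ `&` _) _) -(param_image P); exists u. Qed.

Lemma chart_diff u : U u -> differentiable phi u.
Proof. by have [d _] := param_smooth P 1; exact: d. Qed.

Lemma chart_inv_diff p : W p -> differentiable psi p.
Proof. by have [d _] := param_inv_smooth P 1; exact: d. Qed.

Lemma chart_mul u : U u -> 'J phi u *m 'J psi (phi u) = 1%:M.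
Proof.
move=> Uu; have [Sp Wp] := chart_image Uu.
rewrite -(jacobian_comp (chart_diff Uu) (chart_inv_diff Wp)) -(jacobian_id u).
apply: near_eq_jacobian.
- by apply: differentiable_comp; [exact: chart_diff|exact: chart_inv_diff].
- exact: ex_diff.
- near=> v; rewrite /= (param_K P) //; near: v.
  by apply: open_nbhs_nbhs; split => //; exact: param_openU P.
Unshelve. all: by end_near. Qed.

Lemma chart_tangent u w : U u -> tangent (carrier S) (phi u) (w *m 'J phi u).
Proof.
move=> Uu; exists U, W, phi, psi; split => //; exists u, w; split => //.
by rewrite diff_jacobian.
Qed.

End Chart.

(** Near phi u, the map phi' psi' fixes the image of S under K, and its derivative
    takes values in the tangent plane; so K, which maps S to S near phi u, maps
    tangent vectors to tangent vectors. *)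
Lemma chart_frame U W phi psi U' W' phi' psi'
    (P : parametrization (carrier S) U W phi psi)
    (P' : parametrization (carrier S) U' W' phi' psi')
    (K : 'rV[R]_3 -> 'rV[R]_3) u :
  U u -> W' (K (phi u)) -> differentiable K (phi u) ->
  (\forall z \near phi u, carrier S z -> carrier S (K z)) ->
  'J phi u *m 'J K (phi u) *m
    ('J psi' (K (phi u)) *m 'J phi' (psi' (K (phi u)))) =
  'J phi u *m 'J K (phi u).
Proof.
move=> Uu Wq dK SK.
have dphi := chart_diff P Uu.
have dKphi := differentiable_comp dphi dK.
have [Sp Wp] := chart_image P Uu.
have Sq : carrier S (K (phi u)) by exact: (nbhs_singleton SK).
have [U'q _] := chart_inv P' Sq Wq.
have dpsi' := chart_inv_diff P' Wq.
have dphi' := chart_diff P' U'q.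
have dpsiK := differentiable_comp dKphi dpsi'.
rewrite -(jacobian_comp dphi dK) mulmxA.
rewrite -(jacobian_comp dKphi dpsi') -(jacobian_comp dpsiK dphi').
apply: near_eq_jacobian => //; first exact: differentiable_comp.
have cphi := differentiable_continuous dphi.
have nU : \forall z \near u, U z.
  by apply: open_nbhs_nbhs; split => //; exact: param_openU P.
have nW : \forall z \near u, W' ((K \o phi) z).
  apply: (differentiable_continuous dKphi).
  by apply: open_nbhs_nbhs; split => //; exact: param_openW P'.
have nS : \forall z \near u, carrier S (phi z) -> carrier S (K (phi z)).
  exact: (cphi _ SK).
near=> z.
have Uz : U z by near: z.
have SKz : carrier S (K (phi z)).
  have h : carrier S (phi z) -> carrier S (K (phi z)) by near: z.
  by apply: h; case: (chart_image P Uz).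
have Wz : W' (K (phi z)) by near: z.
by rewrite /= (chart_inv P' SKz Wz).2.
Unshelve. all: by end_near. Qed.

(** The rows of B form a basis of the tangent plane at x, and v *m C gives the
    coordinates of a tangent vector v in that basis. *)
Definition is_frame x (B : 'M[R]_(2, 3)) (C : 'M[R]_(3, 2)) :=
  exists U W phi psi, [/\ parametrization (carrier S) U W phi psi, W (\val x),
    B = 'J phi (psi (\val x)) & C = 'J psi (\val x)].

(** An opaque choice: unification must not unfold the frames down to charts. *)
Lemma frames_exist : {BC : S -> 'M[R]_(2, 3) * 'M[R]_(3, 2) |
  forall x, is_frame x (BC x).1 (BC x).2}.
Proof.
have ex x : exists BC, is_frame x BC.1 BC.2.
  have [U [W [phi [psi [P Wx]]]]] := surface_regular (val_carrier x).
  by exists ('J phi (psi (\val x)), 'J psi (\val x)), U, W, phi, psi.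
by exists (fun x => sval (cid (ex x))) => x; exact: (svalP (cid (ex x))).
Qed.

Definition frame x : 'M[R]_(2, 3) := (sval frames_exist x).1.
Definition coframe x : 'M[R]_(3, 2) := (sval frames_exist x).2.

Lemma frameP x : is_frame x (frame x) (coframe x).
Proof. exact: (svalP frames_exist). Qed.

Lemma frameK x : frame x *m coframe x = 1%:M.
Proof.
have [U [W [phi [psi [P Wx -> ->]]]]] := frameP x.
have [Ux e] := chart_inv P (val_carrier x) Wx.
by rewrite -{2}e (chart_mul P Ux).
Qed.

Lemma frame_tangent x w : tangent (carrier S) (\val x) (w *m frame x).
Proof.
have [U [W [phi [psi [P Wx -> _]]]]] := frameP x.
have [Ux e] := chart_inv P (val_carrier x) Wx.
have := chart_tangent P w Ux; rewrite e; exact.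
Qed.

(** The projection on the tangent plane given by a chart, which depends on the
    chart, fixes all tangent vectors. *)
Lemma chart_tangentK U W phi psi (P : parametrization (carrier S) U W phi psi)
    x v : W (\val x) -> tangent (carrier S) (\val x) v ->
  v *m ('J psi (\val x) *m 'J phi (psi (\val x))) = v.
Proof.
move=> Wx [U' [W' [phi' [psi' [P' [u [w [U'u e ->]]]]]]]].
rewrite diff_jacobian -mulmxA; congr (w *m _).
have := @chart_frame _ _ _ _ _ _ _ _ P' P id u U'u.
rewrite e jacobian_id mulmx1; apply; [exact: Wx|exact: ex_diff|].
exact: (filterE (F := nbhs (\val x))).
Qed.

Lemma tangentK x v : tangent (carrier S) (\val x) v ->
  v *m coframe x *m frame x = v.
Proof.
have [U [W [phi [psi [P Wx -> ->]]]]] := frameP x.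
by move=> /(chart_tangentK P Wx); rewrite mulmxA.
Qed.

Lemma tangentP x v : tangent (carrier S) (\val x) v <-> (v <= frame x)%MS.
Proof.
split=> [/tangentK <-|/submxP[w ->]]; first exact: submxMl.
exact: frame_tangent.
Qed.

Lemma ext_near F x H : C1_extension (incl_map F) x H ->
  \forall z \near \val x, carrier S z -> carrier S (H z).
Proof.
move=> [W [oW Wx _ HF]]; near=> z => /mem_set Sz.
have := HF (exist _ z Sz) => /= ->; first exact: val_carrier.
by near: z; exact: open_nbhs_nbhs.
Unshelve. all: by end_near. Qed.

Lemma ext_diff F x H : C1_extension (incl_map F) x H -> differentiable H (\val x).
Proof. by move=> [W [_ Wx [d _] _]]; exact: d. Qed.

Lemma ext_val F x H : C1_extension (incl_map F) x H -> H (\val x) = \val (F x).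
Proof. by move=> [W [_ Wx _ e]]; exact: e. Qed.

(** That is, the differential of F takes its values in the tangent plane at F x,
    whose vectors are the only ones fixed by coframe (F x) *m frame (F x). *)
Lemma ext_frame F x H : C1_extension (incl_map F) x H ->
  frame x *m 'J H (\val x) *m coframe (F x) *m frame (F x) =
  frame x *m 'J H (\val x).
Proof.
move=> HF.
have [U [W [phi [psi [P Wx -> _]]]]] := frameP x.
have [U' [W' [phi' [psi' [P' Wx' -> ->]]]]] := frameP (F x).
have [Ux e] := chart_inv P (val_carrier x) Wx.
rewrite -(ext_val HF) in Wx' *; move: (psi _) Ux e => u Uu e.
have dH := ext_diff HF; have SH := ext_near HF.
rewrite -{}e in Wx' dH SH *.
have E := chart_frame P P' Uu Wx' dH SH.
by rewrite -[LHS]mulmxA.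
Qed.

(** Also opaque, to keep [differential] from being unfolded. *)
Lemma diff_mx_exists : {D : (S -> S) -> S -> 'M[R]_3 |
  forall F x v, differential F x v = v *m D F x}.
Proof.
exists (fun F x => lin1_mx (differential F x)) => F x v.
by rewrite /differential mul_rV_lin1.
Qed.

Definition diff_mx := sval diff_mx_exists.

Lemma differential_mulmx F x v : differential F x v = v *m diff_mx F x.
Proof. exact: (svalP diff_mx_exists). Qed.

(** The matrix of the differential of F at x in the chosen frames, acting on row
    vectors: composition of maps becomes multiplication in the opposite order. *)
Definition dmx F x : 'M[R]_2 := frame x *m diff_mx F x *m coframe (F x).

Lemma ext_differential F x H : C1_extension (incl_map F) x H ->
  frame x *m diff_mx F x = frame x *m 'J H (\val x).
Proof.
move=> HF; apply/row_matrixP => i.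
have eL : row i (frame x *m diff_mx F x) = differential F x (row i (frame x)).
  by rewrite row_mul [RHS]differential_mulmx.
have eR : row i (frame x *m 'J H (\val x)) = 'd H (\val x) (row i (frame x)).
  by rewrite row_mul [RHS]diff_jacobian.
have tan : tangent (carrier S) (\val x) (row i (frame x)).
  by rewrite rowE; exact: frame_tangent.
exact (etrans eL (etrans (differentialE HF tan) (esym eR))).
Qed.

Lemma dmxE F x H : C1_extension (incl_map F) x H ->
  dmx F x = frame x *m 'J H (\val x) *m coframe (F x).
Proof. by move=> HF; rewrite /dmx (ext_differential HF). Qed.

Lemma frame_dmx F x : C1_at F x ->
  frame x *m diff_mx F x = dmx F x *m frame (F x).
Proof.
move=> [H HF]; rewrite (ext_differential HF) (dmxE HF).
exact: esym (ext_frame HF).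
Qed.

Lemma differential_dmx F x v : C1_at F x -> tangent (carrier S) (\val x) v ->
  differential F x v = v *m coframe x *m dmx F x *m frame (F x).
Proof.
move=> cF /tangentK e; rewrite -[in LHS]e differential_mulmx.
by rewrite -[LHS]mulmxA (frame_dmx cF) mulmxA.
Qed.

Lemma ext_id x : C1_extension (incl_map (@id S)) x id.
Proof.
exists setT; split => //; first exact: openT.
apply/C1_mapP; first exact: openT.
split=> p _; first exact: ex_diff.
have -> : jacobian (@id 'rV[R]_3) = cst 1%:M.
  by apply/funext => q; exact: jacobian_id.
exact: (@cst_continuous _ _ (1%:M : 'M[R]_3) p).
Qed.

Lemma C1_at_id x : C1_at id x. Proof. by exists id; exact: ext_id. Qed.

Lemma ext_comp F G x H K :
  C1_extension (incl_map F) x H -> C1_extension (incl_map G) (F x) K ->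
  C1_extension (incl_map (G \o F)) x (K \o H).
Proof.
move=> HF KG; have Hx := ext_val HF.
case: HF => W [oW Wx /(C1_mapP _ oW) cH eH].
case: KG => W' [oW' Wx' /(C1_mapP _ oW') cK eK].
have oWW : open (W `&` H @^-1` W').
  rewrite openE => z [Wz Wz']; apply: filterI; first exact: open_nbhs_nbhs.
  apply: (differentiable_continuous (cH.1 z Wz)); exact: open_nbhs_nbhs.
exists (W `&` H @^-1` W'); split => //.
- by split => //=; rewrite Hx.
- apply/C1_mapP => //; exact: C1_map_comp.
- by move=> y [Wy]; rewrite /= eH // => W'y; rewrite eK.
Qed.

Lemma C1_at_comp F G x : C1_at F x -> C1_at G (F x) -> C1_at (G \o F) x.
Proof. by move=> [H HF] [K KG]; exists (K \o H); exact: ext_comp. Qed.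

Lemma dmx_comp F G x : C1_at F x -> C1_at G (F x) ->
  dmx (G \o F) x = dmx F x *m dmx G (F x).
Proof.
move=> [H HF] [K KG]; rewrite (dmxE HF) (dmxE KG) (dmxE (ext_comp HF KG)).
rewrite (jacobian_comp (ext_diff HF)); last first.
  by rewrite (ext_val HF); exact: ext_diff KG.
by rewrite (ext_val HF) !mulmxA (ext_frame HF).
Qed.

Lemma dmx_id x : dmx id x = 1%:M.
Proof.
by rewrite (dmxE (ext_id x)) jacobian_id mulmx1 frameK.
Qed.

End Frames.

(** * Local estimates for the differential *)

(** A zero z of g - Id satisfies (z - u) (J - 1) = o(z - u), where J is the Jacobian
    matrix at u. *)
Lemma isolated_fixed_row (R : realType) m (g : 'rV[R]_m -> 'rV[R]_m) u :
  differentiable g u -> g u = u -> 'J g u - 1%:M \in unitmx ->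
  \forall z \near u, g z = z -> z = u.
Proof.
move=> dg gu inv; set M := 'J g u - 1%:M in inv.
have K0 : 0 < 2 * (m%:R * `|invmx M| + 1).
  by rewrite mulr_gt0 // ltr_wpDl // mulr_ge0.
have /eqaddoP /(_ (2 * (m%:R * `|invmx M| + 1))^-1) := diff_locally dg.
rewrite invr_gt0 => /(_ K0) no.
have n0 : \forall h \near 0, g (h + u) = h + u -> h = 0.
  apply: filterS no => h oh gh.
  have {}oh : `|(h + u) - (u + h *m 'J g u)| <=
      (2 * (m%:R * `|invmx M| + 1))^-1 * `|h|.
    by move: oh; rewrite !fctE /= gh gu diff_jacobian.
  have hM : h *m M = - ((h + u) - (u + h *m 'J g u)).
    by rewrite /M mulmxBr mulmx1 opprB (addrC u) opprD addrACA subrr addr0.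
  rewrite -normrN -hM in oh.
  have : `|h| <= m%:R * `|h *m M| * `|invmx M|.
    by rewrite -{1}[h]mulmx1 -(mulmxV inv) mulmxA mulmx_norm_le.
  have -> : m%:R * `|h *m M| * `|invmx M| = `|h *m M| * (m%:R * `|invmx M|).
    by ring.
  move: oh; rewrite ler_pdivlMl //.
  set t := `|h *m M|; set r := m%:R * `|invmx M|.
  have t0 : 0 <= t by exact: normr_ge0.
  have r0 : 0 <= r by exact: mulr_ge0.
  move=> h1 h2; apply/eqP; rewrite -normr_le0; nra.
have c : z - u @[z --> u] --> u - u.
  exact (@cvgB _ _ _ (nbhs u) _ id (cst u) u u (@cvg_id _ (nbhs u))
    (@cvg_cst _ u _ (nbhs u) _)).
rewrite subrr in c.
have nz : \forall z \near u, g (z - u + u) = z - u + u -> z - u = 0 := c _ n0.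
near=> z => gz; apply/eqP; rewrite -subr_eq0; apply/eqP.
have : g (z - u + u) = z - u + u -> z - u = 0 by near: z.
by rewrite subrK; apply.
Unshelve. all: by end_near. Qed.

(** Here Qx and Qy are the projections on the tangent planes at two points, and Jx,
    Jy the Jacobian matrices of the same map at these points; v is tangent at the
    second one, and eta measures how close the points must be. *)
Lemma sub_id_estimate (R : realType) (v : 'rV[R]_3) (Jx Jy Qx Qy : 'M[R]_3)
    (c c' : R) : 0 <= c -> c < c' ->
  let eta := (c' - c) / (3 + 3 * c + 9 * `|Jx - 1%:M|) in
  v *m Qy = v -> `|v *m Qx *m Jx - v *m Qx| <= c * `|v *m Qx| ->
  `|Jx - Jy| <= eta -> `|Qx - Qy| <= eta -> `|v *m Jy - v| <= c' * `|v|.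
Proof.
move=> c0 cc' eta vQ Dw Jxy Qxy.
set k := `|Jx - 1%:M| in eta Jxy Qxy *.
have den : 0 < 3 + 3 * c + 9 * k.
  have k0 : 0 <= k by exact: normr_ge0.
  lra.
have eta_def : (3 + 3 * c + 9 * k) * eta = c' - c.
  by rewrite mulrC divfK // gt_eqF.
have E : v *m Jy - v = (v *m Qx *m Jx - v *m Qx) + v *m (Qy - Qx) *m (Jx - 1%:M)
    - v *m (Jx - Jy).
  rewrite [v *m (Qy - Qx)]mulmxBr vQ [_ *m (Jx - 1%:M)]mulmxBr mulmxBl mulmx1.
  rewrite [v *m (Jx - Jy)]mulmxBr.
  move: (v *m Qx *m Jx) (v *m Qx) (v *m Jx) (v *m Jy) => w1 w2 w3 w4.
  by apply/rowP => j; rewrite !mxE; ring.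
have n1 : `|v *m (Jx - Jy)| <= 3 * `|v| * eta.
  by apply: le_trans (mulmx_norm_le _ _) _; rewrite ler_wpM2l ?mulr_ge0.
have n2 : `|v *m (Qy - Qx)| <= 3 * `|v| * eta.
  by apply: le_trans (mulmx_norm_le _ _) _; rewrite ler_wpM2l ?mulr_ge0 // distrC.
have n3 : `|v *m (Qy - Qx) *m (Jx - 1%:M)| <= 3 * (3 * `|v| * eta) * k.
  apply: le_trans (mulmx_norm_le _ _) _.
  by rewrite ler_wpM2r // ler_wpM2l.
have n4 : `|v *m Qx| <= `|v| + 3 * `|v| * eta.
  have -> : v *m Qx = v - v *m (Qy - Qx) by rewrite mulmxBr vQ subKr.
  by apply: le_trans (ler_normB _ _) _; rewrite lerD2l.
have n5 := ler_wpM2l c0 n4.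
rewrite E; apply: le_trans (ler_normB _ _) _.
have := ler_normD (v *m Qx *m Jx - v *m Qx) (v *m (Qy - Qx) *m (Jx - 1%:M)).
have -> : c' = c + (3 + 3 * c + 9 * k) * eta by rewrite eta_def addrC subrK.
by lra.
Qed.

Section Local.
Context {R : realType} {S : closed_oriented_surface R}.
Implicit Types (F : S -> S) (x y : S) (L : set S).

Lemma val_continuous : continuous (fun y : S => \val y : 'rV[R]_3).
Proof. exact: (@initial_continuous S 'rV[R]_3 \val). Qed.

Lemma near_val x (A : set 'rV[R]_3) : nbhs (\val x) A ->
  \forall y \near x, A (\val y).
Proof. exact: val_continuous. Qed.

Lemma near_ext F x H : C1_extension (incl_map F) x H ->
  \forall y \near x, C1_extension (incl_map F) y H.
Proof.
move=> [W [oW Wx cH eH]]; have nW := near_val (open_nbhs_nbhs (conj oW Wx)).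
by apply: filterS nW => y Wy; exists W.
Qed.

Lemma near_C1_at F x : C1_at F x -> \forall y \near x, C1_at F y.
Proof. by move=> [H /near_ext nH]; apply: filterS nH => y; exists H. Qed.

Lemma ext_jacobian_cvg F x H : C1_extension (incl_map F) x H ->
  'J H (\val y) @[y --> x] --> 'J H (\val x).
Proof.
move=> [W [oW Wx /(C1_mapP _ oW) [_ cH] _]].
exact (@continuous_cvg _ _ _ (nbhs x) _ _ _ _ (cH _ Wx) (@val_continuous x)).
Qed.

Lemma ext_differential_val F x H v : C1_extension (incl_map F) x H ->
  tangent (carrier S) (\val x) v -> differential F x v = v *m 'J H (\val x).
Proof.
by move=> HF tan; rewrite -diff_jacobian; exact: differentialE HF tan.
Qed.

(** Near each point a single C^1 extension computes the differentials at all points,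
    and its Jacobian matrix is locally bounded. *)
Lemma differential_bounded L F : compact L -> (forall x, L x -> C1_at F x) ->
  exists K, forall x v, L x -> tangent (carrier S) (\val x) v ->
    `|differential F x v| <= K * `|v|.
Proof.
move=> /compact_near_coveringP cL cF.
have nK : \forall K \near (+oo : set_system R), L `<=` [set x | forall v,
    tangent (carrier S) (\val x) v -> `|differential F x v| <= K * `|v|].
  apply: cL => x Lx; have [H HF] := cF x Lx.
  exists ([set y | C1_extension (incl_map F) y H /\
                   `|'J H (\val y)| < `|'J H (\val x)| + 1],
          [set K | 3 * (`|'J H (\val x)| + 1) <= K]).
    split; last exact: nbhs_pinfty_ge.
    apply: filterI; first exact: near_ext.
    have /cvgrPdist_lt /(_ 1 ltr01) nJ := ext_jacobian_cvg HF.
    by apply: filterS nJ => y /norm_lt_dist.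
  move=> [y K] /= [[Hy Jy] le] v tan; rewrite (ext_differential_val Hy tan).
  apply: le_trans (mulmx_norm_le _ _) _.
  rewrite mulrAC ler_wpM2r //; apply: le_trans le.
  by rewrite ler_wpM2l // ltW.
have [K KL] := filter_ex nK.
by exists K => x v Lx; exact: KL.
Qed.

(** In a chart, F - Id is injective at first order at x, so that it vanishes nowhere
    else near x. *)
Lemma isolated_fixed_point F x : Fix F x -> C1_at F x ->
  dmx F x - 1%:M \in unitmx ->
  \forall y \near x, Fix F y -> y = x.
Proof.
move=> Fx [H HF]; rewrite (dmxE HF) Fx.
have [U [W [phi [psi [P Wx -> ->]]]]] := frameP x.
have [Uu e] := chart_inv P (val_carrier x) Wx.
have dH := ext_diff HF; have Hx := ext_val HF; rewrite Fx in Hx.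
move eu : (psi (\val x)) => u in Uu e *.
have dphi := chart_diff P Uu.
have dHp : differentiable H (phi u) by rewrite e.
have dHphi := differentiable_comp dphi dHp.
have Hu : (H \o phi) u = \val x by rewrite /= e.
have dpsi : differentiable psi ((H \o phi) u).
  by have d := chart_inv_diff P Wx; rewrite -Hu in d.
have dg := differentiable_comp dHphi dpsi.
have Jg : 'J (psi \o (H \o phi)) u =
    'J phi u *m 'J H (\val x) *m 'J psi (\val x).
  by rewrite (jacobian_comp dHphi dpsi) (jacobian_comp dphi dHp) Hu e.
rewrite -Jg => inv.
have gu : (psi \o (H \o phi)) u = u by rewrite /= e Hx eu.
have iso := isolated_fixed_row dg gu inv.
have cpsi : psi (\val y) @[y --> x] --> u.
  rewrite -eu; have c := differentiable_continuous (chart_inv_diff P Wx).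
  exact (@continuous_cvg _ _ _ (nbhs x) _ _ _ _ c (@val_continuous x)).
have nW := near_val (open_nbhs_nbhs (conj (param_openW P) Wx)).
have next := near_ext HF.
have niso : \forall y \near x,
    (psi \o (H \o phi)) (psi (\val y)) = psi (\val y) -> psi (\val y) = u.
  exact: (cpsi _ iso).
near=> y => Fy.
have Wy : W (\val y) by near: y.
have [_ ey] := chart_inv P (val_carrier y) Wy.
have Hy : C1_extension (incl_map F) y H by near: y.
have psiy : psi (\val y) = u.
  have imp : (psi \o (H \o phi)) (psi (\val y)) = psi (\val y) ->
    psi (\val y) = u by near: y.
  by apply: imp; rewrite /= ey (ext_val Hy) Fy.
by apply: val_inj; rewrite -ey psiy e.
Unshelve. all: by end_near. Qed.

(** A vector v tangent at y is compared with its image under the projection on the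
    tangent plane at x given by a chart; this projection depends continuously on the
    point, and the one at y fixes v. *)
Lemma near_differential_sub_id F x c c' : 0 <= c -> c < c' -> Fix F x ->
  C1_at F x ->
  (forall v, tangent (carrier S) (\val x) v ->
    `|differential F x v - v| <= c * `|v|) ->
  \forall y \near x, forall v, tangent (carrier S) (\val y) v ->
    `|differential F y v - v| <= c' * `|v|.
Proof.
move=> c0 cc' Fx [H HF] Dx.
have [U [W [phi [psi [P Wx _ _]]]]] := frameP x.
have [Uu e] := chart_inv P (val_carrier x) Wx.
pose Q (y : S) := 'J psi (\val y) *m 'J phi (psi (\val y)).
have cQ : Q y @[y --> x] --> Q x.
  have cJpsi : 'J psi (\val y) @[y --> x] --> 'J psi (\val x).
    have [_ cp] := (C1_mapP _ (param_openW P)).1 (param_inv_smooth P 1).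
    exact (@continuous_cvg _ _ _ (nbhs x) _ _ _ _ (cp _ Wx) (@val_continuous x)).
  have cpsi : psi (\val y) @[y --> x] --> psi (\val x).
    have c1 := differentiable_continuous (chart_inv_diff P Wx).
    exact (@continuous_cvg _ _ _ (nbhs x) _ _ _ _ c1 (@val_continuous x)).
  have cJphi : 'J phi (psi (\val y)) @[y --> x] --> 'J phi (psi (\val x)).
    have [_ cp] := (C1_mapP _ (param_openU P)).1 (param_smooth P 1).
    exact (@continuous_cvg _ _ _ (nbhs x) _ _ _ _ (cp _ Uu) cpsi).
  exact (cvg_mulmx cJpsi cJphi).
pose k := `|'J H (\val x) - 1%:M|.
pose eta := (c' - c) / (3 + 3 * c + 9 * k).
have den : 0 < 3 + 3 * c + 9 * k.
  have k0 : 0 <= k by exact: normr_ge0.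
  lra.
have eta0 : 0 < eta by rewrite divr_gt0 // subr_gt0.
have /cvgrPdist_lt /(_ eta eta0) nJ := ext_jacobian_cvg HF.
have /cvgrPdist_lt /(_ eta eta0) nQ := cQ.
have nW := near_val (open_nbhs_nbhs (conj (param_openW P) Wx)).
have next := near_ext HF.
near=> y => v tan.
have Wy : W (\val y) by near: y.
have Hy : C1_extension (incl_map F) y H by near: y.
have Jy : `|'J H (\val x) - 'J H (\val y)| < eta by near: y.
have Qy : `|Q x - Q y| < eta by near: y.
rewrite (ext_differential_val Hy tan).
have vQ : v *m Q y = v.
  exact (chart_tangentK P Wy tan).
have wQ : tangent (carrier S) (\val x) (v *m Q x).
  have := chart_tangent P (v *m 'J psi (\val x)) Uu.
  by rewrite e -mulmxA.
have Dw := Dx _ wQ; rewrite (ext_differential_val HF wQ) in Dw.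
exact (sub_id_estimate c0 cc' vQ Dw (ltW Jy) (ltW Qy)).
Unshelve. all: by end_near. Qed.

End Local.

(** * The Riemannian and the ambient distances *)

Section Distance.
Context {R : realType} {S : closed_oriented_surface R}.
Implicit Types (x y : S) (L O : set S).

Lemma derivable_entry m k (g : R -> 'M[R]_(m, k)) t i j : derivable g t 1 ->
  derivable (fun s => g s i j) t 1 /\
  derive1 (fun s => g s i j) t = derive1 g t i j.
Proof.
move=> dg; rewrite !derive1E.
have c : (fun h => h^-1 *: ((g \o shift t) (h *: 1) - g t)) @ (0:R)^'
    --> 'D_1 g t by exact: dg.
have {}c : (fun h => (h^-1 *: ((g \o shift t) (h *: 1) - g t)) i j) @ (0:R)^'
    --> 'D_1 g t i j.
  exact (cvg_entry c).
have e : (fun h => (h^-1 *: ((g \o shift t) (h *: 1) - g t)) i j) =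
  (fun h => h^-1 *: (((fun s => g s i j) \o shift t) (h *: 1) - g t i j)).
  by apply/funext => h; rewrite !mxE.
rewrite e in c; split; last first.
  exact (cvg_lim (@norm_hausdorff _ R^o) c).
by apply/cvg_ex; exists ('D_1 g t i j).
Qed.

Lemma continuous_enorm k : continuous (@enorm R k).
Proof.
move=> v.
apply: (@continuous_comp _ _ _ (fun w : 'rV[R]_k => dot w w) Num.sqrt);
  last exact: sqrt_continuous.
have ci i : w 0 i * w 0 i @[w --> v] --> v 0 i * v 0 i.
  have c := @coord_continuous R 1 k 0 i v.
  exact (@cvgM _ _ (nbhs v) _ (fun w : 'rV[R]_k => w 0 i) _ _ _ c c).
exact (@cvg_big _ _ _ 0 xpredT (@add_continuous R^o) _ (nbhs v) _ _ _ _
  (fun i _ => ci i)).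
Qed.

Lemma increment_le_integral (F f e : R -> R) :
  (forall t, derivable F t 1) -> derive1 F = f -> continuous f -> continuous e ->
  (forall t, f t <= e t) ->
  ((F 1 - F 0)%:E <= \int[lebesgue_measure]_(t in `[0%R, 1%R]) (e t)%:E)%E.
Proof.
move=> dF F'f cf ce fe.
have int (g : R -> R) : continuous g ->
    lebesgue_measure.-integrable `[0%R, 1%R] (EFin \o g).
  move=> cg; apply: continuous_compact_integrable; first exact: segment_compact.
  exact: continuous_subspaceT.
have cF : continuous F by move=> t; apply/differentiable_continuous/derivable1_diffP.
rewrite EFinB -(@continuous_FTC2 _ f F 0 1 ltr01).
- apply: (le_integral _ (int f cf) (int e ce)); first exact: measurable_itv.
  by move=> t _; rewrite lee_fin.
- exact: continuous_subspaceT.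
- split=> [t _|//|].
  - exact: dF.
  - exact/cvg_at_right_filter/cF.
  - exact/cvg_at_left_filter/cF.
- by move=> t _; rewrite F'f.
Qed.

(** The length of a curve bounds the increment of each of its coordinates. *)
Lemma norm_le_sdist x y r : 0 <= r -> (sdist x y < r%:E)%E ->
  `|\val x - \val y| <= r.
Proof.
move=> r0 /ereal_inf_lt [_ [g [dg cg _ g0 g1] <-] len].
apply: mx_norm_le => // i j; rewrite ord1 {i}.
have dgj t := derivable_entry 0 j (dg t).
have ce : continuous (fun t => enorm (derive1 g t)).
  by move=> t; apply: continuous_comp; [exact: cg|exact: continuous_enorm].
have cj : continuous (fun t => derive1 g t 0 j).
  move=> t; exact: cvg_entry (cg t).
have le s (s1 : `|s| = 1) t : s * derive1 g t 0 j <= enorm (derive1 g t).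
  apply: le_trans (ler_norm _) _; rewrite normrM s1 mul1r.
  exact: le_trans (mx_entry_le _ _ _) (norm_le_enorm _).
have main s : `|s| = 1 -> s * (\val y 0 j - \val x 0 j) <= r.
  move=> s1; rewrite -g0 -g1 mulrBr -lee_fin; apply: le_trans (ltW len).
  apply: (@increment_le_integral (fun t => s * g t 0 j)
    (fun t => s * derive1 g t 0 j)) => //.
  - by move=> t; apply: derivableM => //; case: (dgj t).
  - apply/funext => t; rewrite derive1E deriveM //; last by case: (dgj t).
    by rewrite derive_cst scaler0 addr0 -derive1E (dgj t).2.
  - by move=> t; apply: cvgM; [exact: cvg_cst|exact: cj].
  - by move=> t; exact: le.
rewrite !mxE ler_norml; have := main 1 (normr1 _); have := main (-1) (normrN1 _).
by lra.
Qed.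

Lemma lebesgue_number L O : compact L -> (forall x, L x -> nbhs x O) ->
  exists2 d, 0 < d & forall x y, L x -> `|\val x - \val y| < d -> O y.
Proof.
move=> /compact_near_coveringP cL LO.
have nd : \forall d \near 0^'+, L `<=` [set x | forall y,
    `|\val x - \val y| < d -> O y].
  apply: cL => x Lx; have [_ [[W oW <-] Wx sub]] := LO x Lx.
  have /nbhs_ballP [e /= e0 We] := open_nbhs_nbhs (conj oW Wx).
  have e2 : 0 < e / 2 by rewrite divr_gt0.
  exists ([set y | `|\val x - \val y| < e / 2], [set d | d < e / 2]).
    split; last exact: nbhs_right_lt.
    have /cvgrPdist_lt /(_ _ e2) := @val_continuous _ S x; exact.
  move=> [y d] /= [xy de] z yz; apply: sub; apply: We; rewrite -ball_normE /=.
  have := ler_distD (\val y : 'rV[R]_3) (\val x) (\val z); lra.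
have [d [d0 dL]] := filter_ex (filterI (nbhs_right_gt 0) nd).
by exists d => // x y Lx; exact: dL.
Qed.

End Distance.

(** * Diffeomorphisms near L and eigenvalues of their differentials *)

Section Diffeo.
Context {R : realType} {S : closed_oriented_surface R}.
Implicit Types (F G : S -> S) (x y : S) (L : set S).

Lemma C1_diffeo_nearP L (F : homeo S) : C1_diffeo_near L F <->
  forall x, L x -> C1_at F x /\ C1_at (hinv F) (F x).
Proof.
split=> [[V [oV LV cF cFV]] x Lx|cF].
  by split; [exact/cF/LV|apply: cFV; exists x => //; exact: LV].
exists ([set x | C1_at F x] `&` F @^-1` [set y | C1_at (hinv F) y]); split.
- apply: openI; first by rewrite openE => x; exact: near_C1_at.
  apply: open_comp => [x _|]; first exact: hfun_continuous.
  by rewrite openE => x; exact: near_C1_at.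
- by move=> x /cF.
- by move=> x [].
- by move=> _ [x [_ ?] <-].
Qed.

Lemma C1_at_iter L G k : (forall x, L x -> L (G x)) ->
  (forall x, L x -> C1_at G x) -> forall x, L x -> C1_at (iter k G) x.
Proof.
move=> LG cG x Lx; elim: k => [|k IH]; first exact: C1_at_id.
apply: (C1_at_comp IH); apply: cG; elim: k {IH} => //= k; exact: LG.
Qed.

Lemma dmx_iter G x k : Fix G x -> C1_at G x -> dmx (iter k G) x = dmx G x ^+ k.
Proof.
move=> Gx cG; have fixk i : iter i G x = x by elim: i => //= i ->.
have ck : C1_at (iter k G) x.
  by apply: (@C1_at_iter [set x]) => // y ->.
elim: k ck => [|k IH] ck; first exact: dmx_id.
have ck' : C1_at (iter k G) x.
  by apply: (@C1_at_iter [set x]) => // y ->.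
rewrite exprSr -IH //; have := @dmx_comp _ _ (iter k G) G x ck'.
by rewrite fixk; exact.
Qed.

Lemma dmx_cancel F G x : cancel F G -> C1_at F x -> C1_at G (F x) ->
  dmx F x *m dmx G (F x) = 1%:M.
Proof.
move=> FK cF cG; rewrite -(dmx_comp cF cG) -(dmx_id x).
by congr dmx; apply/funext.
Qed.

(** Two bases B and [frame x] of the tangent plane differ by the invertible matrix
    B *m coframe x. *)
Lemma diff_eigenvalueP F x l : Fix F x -> C1_at F x ->
  diff_eigenvalue F x l <-> eigenvalue (map_mx (real_complex R) (dmx F x)) l.
Proof.
move=> Fx cF; have FrD := frame_dmx cF; rewrite Fx in FrD.
split=> [[B [M [fB tB BM]]]|ev]; last first.
  exists (frame x), (dmx F x); split => //.
  - by apply/row_freeP; exists (coframe x); exact: frameK.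
  - exact: tangentP.
  - by move=> i; rewrite differential_mulmx -!row_mul FrD.
suff [Q uQ e] : exists2 Q, Q \in unitmx & Q *m dmx F x = M *m Q.
  move=> ev; rewrite -(@eigenvalue_conj _ _ (map_mx (real_complex R) M) _
    (map_mx (real_complex R) Q)) ?map_unitmx //.
  by rewrite -!map_mxM e.
have BE : B = B *m coframe x *m frame x.
  apply/row_matrixP => i; rewrite !row_mul tangentK //; apply/tB.
  exact: row_sub.
have MB : M *m B = B *m diff_mx F x.
  by apply/row_matrixP => i; rewrite !row_mul -BM differential_mulmx.
exists (B *m coframe x).
  have [X BX] := row_freeP fB.
  have /mulmx1_unit [] // : B *m coframe x *m (frame x *m X) = 1%:M.
  by rewrite mulmxA -BE.
have <- : B *m coframe x *m dmx F x *m frame x *m coframe x =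
    B *m coframe x *m dmx F x by rewrite -mulmxA frameK mulmx1.
by rewrite -[_ *m dmx F x *m _]mulmxA -FrD mulmxA -BE -MB mulmxA.
Qed.

Lemma eigenvalue_le F x K a : Fix F x -> C1_at F x ->
  (forall v, tangent (carrier S) (\val x) v ->
    `|differential F x v| <= K * `|v|) ->
  eigenvalue (dmx F x) a -> `|a| <= K.
Proof.
move=> Fx cF bd /eigenvalueP [v vA v0].
have tan := frame_tangent x v.
have := bd _ tan; rewrite (differential_dmx cF tan) Fx -(mulmxA v) frameK mulmx1.
rewrite vA -scalemxAl normrZ ler_pM2r // normr_gt0.
apply: contra v0 => /eqP e; apply/eqP.
by rewrite -[v]mulmx1 -(frameK x) mulmxA e mul0mx.
Qed.

End Diffeo.

(** By Bernoulli's inequality. *)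
Lemma bounded_powers (R : realType) n (a K : R) : (2 <= n)%N -> 0 <= a ->
  (forall k, a ^+ (n ^ k) <= K) -> a <= 1.
Proof.
move=> n2 a0 bd; rewrite leNgt; apply/negP => a1.
have bern m : 1 + m%:R * (a - 1) <= a ^+ m.
  elim: m => [|m IH]; first by rewrite mul0r addr0.
  rewrite exprS -natr1; apply: le_trans (ler_wpM2l a0 IH).
  have := mulr_ge0 (ler0n R m) (sqr_ge0 (a - 1)); rewrite expr2.
  by move: m%:R => t; lra.
pose k := Num.bound `|K / (a - 1)|.
have := le_trans (bern (n ^ k)%N) (bd k).
have kn : (k <= n ^ k)%N by rewrite ltnW // ltn_expl.
have : K / (a - 1) < k%:R.
  by apply: le_lt_trans (ler_norm _) _; exact: archi_boundP.
rewrite ltr_pdivrMr ?subr_gt0 //.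
have : k%:R <= (n ^ k)%:R :> R by rewrite ler_nat.
move: ((n ^ k)%:R) k%:R => s t; nra.
Qed.

(** * Differentials along a minimal set *)

Section Main.
Context {R : realType} {S : closed_oriented_surface R} {n : nat}
  {f h : homeo S} {L : set S}.
Context (n2 : (2 <= n)%N) (act : BS_action n f h)
  (Lmin : minimal_set f h L) (Lf : L `<=` Fix f)
  (f_C1 : C1_diffeo_near L f) (h_C1 : C1_diffeo_near L h).

Let cL : compact L. Proof. by case: Lmin. Qed.
Let Lh x : L x -> L (h x). Proof. exact: (h_inv Lmin). Qed.
Let LhV x : L x -> L (hinv h x). Proof. exact: (hV_inv Lmin). Qed.

Let cf x : L x -> C1_at f x.
Proof. by move=> Lx; have [] := (C1_diffeo_nearP L f).1 f_C1 x Lx. Qed.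

Let cfV x : L x -> C1_at (hinv f) x.
Proof.
by move=> Lx; have [_] := (C1_diffeo_nearP L f).1 f_C1 x Lx; rewrite (Lf Lx).
Qed.

Let ch x : L x -> C1_at h x.
Proof. by move=> Lx; have [] := (C1_diffeo_nearP L h).1 h_C1 x Lx. Qed.

Let chV x : L x -> C1_at (hinv h) x.
Proof.
move=> Lx; have [_] := (C1_diffeo_nearP L h).1 h_C1 _ (LhV Lx).
by rewrite hinvK.
Qed.

Let L_iter k x : L x -> L (iter k h x). Proof. exact: (iter_h_inv Lmin). Qed.

Let chk k x : L x -> C1_at (iter k h) x.
Proof. exact: C1_at_iter. Qed.

Let chVk k x : L x -> C1_at (iter k (hinv h)) x.
Proof. exact: C1_at_iter. Qed.

Let cfk k x : L x -> C1_at (iter k f) x.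
Proof. by apply: C1_at_iter => // y Ly; rewrite (Lf Ly). Qed.

Local Notation A := (dmx f).

Lemma dmx_hK k x : L x ->
  dmx (iter k h) x *m dmx (iter k (hinv h)) (iter k h x) = 1%:M.
Proof.
move=> Lx; apply: dmx_cancel; first exact/iterK/hfunK.
  exact: chk.
exact/chVk/L_iter.
Qed.

Lemma dmx_fK x : L x -> A x *m dmx (hinv f) x = 1%:M.
Proof.
move=> Lx; have := @dmx_cancel _ _ f (hinv f) x (hfunK f) (cf Lx).
by rewrite (Lf Lx); apply; exact: cfV.
Qed.

Lemma dmx_unit x : L x -> A x \in unitmx.
Proof. by move=> /dmx_fK /mulmx1_unit []. Qed.

Lemma dmx_h_unit k x : L x -> dmx (iter k h) x \in unitmx.
Proof. by move=> /(dmx_hK k) /mulmx1_unit []. Qed.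

(** The differential at x of the relation h^k f = f^(n^k) h^k. *)
Lemma dmx_conj k x : L x ->
  dmx (iter k h) x *m A (iter k h x) ^+ (n ^ k) = A x *m dmx (iter k h) x.
Proof.
move=> Lx; rewrite -(dmx_iter _ (Lf (L_iter k Lx)) (cf (L_iter k Lx))).
rewrite -dmx_comp; [|exact: chk|exact/cfk/L_iter].
have := iter_action act k 1; rewrite mul1n => <-.
rewrite -[iter 1 f]/(f : S -> S) dmx_comp ?(Lf Lx) //; [exact: cf|exact: chk].
Qed.

(** At an isolated point of L the orbit under h is finite, and A x is conjugate
    to a power of itself. *)
Lemma isolated_unipotent x : L x -> A x - 1%:M \in unitmx ->
  exists2 N, (0 < N)%N & forall y, L y -> (A y ^+ N - 1) ^+ 2 = 0.
Proof.
move=> Lx inv.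
have iso := isolated_fixed_point (Lf Lx) (cf Lx) inv.
have [|p p0 per] := isolated_periodic Lmin Lf Lx iso.
  by move=> y [imp Ly]; exact/imp/Lf.
have q2 : (2 <= n ^ p)%N.
  by rewrite (leq_trans n2) // -{1}(expn1 n) leq_exp2l.
exists (n ^ p * ((n ^ p) ^ 2 - 1))%N.
  by rewrite muln_gt0 subn_gt0 -{2}(expn0 (n ^ p)) ltn_exp2l // andbT ltnW.
move=> y Ly; apply: (real_conj_power_unipotent q2 (dmx_unit Ly) (dmx_h_unit p Ly)).
by have := dmx_conj p Ly; rewrite per.
Qed.

(** Going backwards along the orbit of x, the eigenvalue a of A x gives the
    eigenvalue a^(n^k) at h^-k x, and the differentials of f and of its inverse
    are bounded on L. *)
Lemma eigenvalue_norm1 x a : L x -> eigenvalue (A x) a -> `|a| = 1.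
Proof.
move=> Lx ea.
have [K bd] := differential_bounded cL cf.
have [K' bd'] := differential_bounded cL cfV.
have back k : exists2 y, L y & eigenvalue (A y) (a ^+ (n ^ k)).
  have Ly := iter_hV_inv Lmin k Lx.
  exists (iter k (hinv h) x) => //.
  rewrite (eigenvalue_conj _ (dmx_h_unit k Ly) (dmx_conj k Ly)).
  by rewrite (iterK k (hinvK h)) eigenvalue_exp.
apply/eqP; rewrite eq_le; apply/andP; split.
  apply: (@bounded_powers _ n _ K n2) => // k; rewrite -normrX.
  have [y Ly ey] := back k.
  by apply: (eigenvalue_le (Lf Ly) (cf Ly) _ ey) => v; exact: bd.
have a0 : 0 < `|a|.
  rewrite normr_gt0; apply: contraTneq ea => ->; apply/eigenvalueP => -[v].
  rewrite scale0r => vA; rewrite -[v]mulmx1 -(dmx_fK Lx) mulmxA vA mul0mx.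
  by rewrite eqxx.
rewrite -invf_le1 //.
apply: (@bounded_powers _ n _ K' n2) => [|k]; first by rewrite invr_ge0.
rewrite exprVn -normrX -normfV.
have [y Ly ey] := back k.
have fVy : Fix (hinv f) y by exact: fV_fix Lf _ Ly.
apply: (eigenvalue_le fVy (cfV Ly)) => [v|]; first exact: bd'.
exact: eigenvalue_inverse (dmx_fK Ly) ey.
Qed.

(** Either A x - 1 is invertible at some point x, which is then isolated in L, or
    every A x has the eigenvalue 1 and another one equal to 1 or -1. *)
Lemma unipotent_power :
  exists2 N, (0 < N)%N & forall x, L x -> (A x ^+ N - 1) ^+ 2 = 0.
Proof.
have [[x [Lx inv]]|none] := pselect (exists x, L x /\ A x - 1%:M \in unitmx).
  exact: isolated_unipotent inv.
exists 2 => // x Lx.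
have e1 : eigenvalue (A x) 1.
  have /det0P [v v0 vA] : \det (A x - 1%:M) == 0.
    apply/negPn/negP => d0; apply: none; exists x; split => //.
    by rewrite unitmxE unitfE.
  apply/eigenvalueP; exists v => //; apply/eqP.
  by rewrite scale1r -subr_eq0 -{2}[v]mulmx1 -mulmxBr vA.
have [d ed AB] := second_eigenvalue e1.
apply: (unipotent_exp AB); first by rewrite expr1n.
by rewrite -real_normK ?num_real // (eigenvalue_norm1 Lx ed) expr1n.
Qed.

(** ** Roots of f^N *)

Section Root.
Context (N : nat) (N0 : (0 < N)%N)
  (unip : forall x, L x -> (A x ^+ N - 1) ^+ 2 = 0).

Local Notation root := (conj_root f h N).

Lemma root_fix k x : L x -> root k x = x.
Proof.
move=> Lx /=; have fN i y : L y -> iter i f y = y.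
  by move=> Ly; elim: i => //= i ->; exact: Lf.
by rewrite fN ?(iterK k (hfunK h)) //; exact: L_iter.
Qed.

Lemma root_C1 k : C1_diffeo_near L (root k).
Proof.
apply/C1_diffeo_nearP => x Lx; rewrite root_fix //.
have Lk := L_iter k Lx.
have fix_iter (g : S -> S) i : (forall y, L y -> g y = y) ->
    iter i g (iter k h x) = iter k h x.
  by move=> gL; elim: i => //= i ->; exact: gL.
have cfVk : C1_at (iter N (hinv f)) (iter k h x).
  by apply: (@C1_at_iter _ _ L) => // y Ly; rewrite ?(fV_fix Lf Ly) //; exact: cfV.
split; rewrite /conj_root /=; apply: C1_at_comp.
- exact: chk.
- apply: C1_at_comp; first exact: cfk.
  by rewrite fix_iter; [exact: chVk|exact: Lf].
- exact: chk.
- apply: C1_at_comp; first exact: cfVk.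
  by rewrite fix_iter; [exact: chVk|exact: fV_fix Lf].
Qed.

Lemma root_C1_at k x : L x -> C1_at (root k) x.
Proof. by move=> Lx; have [] := (C1_diffeo_nearP L (root k)).1 (root_C1 k) x Lx. Qed.

Lemma root_unipotent k x : L x -> (dmx (root k) x - 1) ^+ 2 = 0.
Proof.
move=> Lx; have Lk := L_iter k Lx.
pose P := dmx (iter k h) x.
pose P' := dmx (iter k (hinv h)) (iter k h x).
have PP' : P *m P' = 1%:M by exact: dmx_hK.
have fNk : iter N f (iter k h x) = iter k h x.
  by elim: (N) => //= i ->; exact: Lf.
have -> : dmx (root k) x = P *m A (iter k h x) ^+ N *m P'.
  have cVN : C1_at (iter k (hinv h)) (iter N f (iter k h x)).
    by rewrite fNk; exact: chVk.
  rewrite /conj_root /= (dmx_comp (chk k Lx)); last exact: C1_at_comp (cfk N Lk) cVN.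
  by rewrite (dmx_comp (cfk N Lk) cVN) fNk (dmx_iter _ (Lf Lk) (cf Lk)) mulmxA.
exact: conj_unipotent PP' (unip Lk).
Qed.

(** The differential of the root at x is 1 + U with U^2 = 0, hence that of f^N is
    (1 + U)^(n^k) = 1 + n^k U. *)
Lemma root_differential k x v : L x -> tangent (carrier S) (\val x) v ->
  differential (iter N f) x v - v =
  (n ^ k)%:R *: (differential (root k) x v - v).
Proof.
move=> Lx tan; have cr := root_C1_at k Lx.
have fx := root_fix k Lx.
have fNx : iter N f x = x by elim: (N) => //= i ->; exact: Lf.
pose U := dmx (root k) x - 1.
have U2 : U ^+ 2 = 0 by exact: root_unipotent.
have e : dmx (iter N f) x = 1 + U *+ (n ^ k).
  rewrite -(iter_conj_root act N k) dmx_iter // -expr1D_nilpotent //.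
  by rewrite /U addrC subrK.
have sub F M : F x = x -> C1_at F x -> dmx F x = 1 + M ->
    differential F x v - v = v *m coframe x *m M *m frame x.
  move=> Fx cF dF; rewrite (differential_dmx cF tan) dF Fx mulmxDr mulmxDl.
  by rewrite mulmx1 (tangentK tan) addrC addKr.
have e1 : dmx (root k) x = 1 + U by rewrite /U addrC subrK.
have eN := sub _ _ fNx (cfk N Lx) e.
have eR := congr1 (fun w => (n ^ k)%:R *: w) (sub _ _ fx cr e1).
apply: (etrans eN); apply: (etrans _ (esym eR)).
by rewrite -scaler_nat -scalemxAr -scalemxAl.
Qed.

(** On L, [root_differential] divides the distance from the differential of f^N to
    the identity by n^k; [near_differential_sub_id] extends the estimate to a
    neighborhood. *)
Lemma root_close eps : 0 < eps -> exists k, forall x, L x ->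
  \forall y \near x, C1_at (root k) y /\ (C1_dist_id_at (root k) y < eps%:E)%E.
Proof.
move=> eps0; have [K bd] := differential_bounded cL (cfk N).
(* The Euclidean norm is at most 3 times the sup norm: a displacement of c and a
   differential within 2 c of the identity, in sup norm, contribute at most 9 c. *)
pose c := eps / 12; have c0 : 0 < c by rewrite divr_gt0.
pose k := Num.bound ((`|K| + 1) / c).
have kK : `|K| + 1 <= c * (n ^ k)%:R.
  rewrite mulrC -ler_pdivrMr //.
  have /ltW le : (`|K| + 1) / c < k%:R.
    by apply: archi_boundP; rewrite divr_ge0 ?ltW // ltr_wpDl.
  by apply: (le_trans le); rewrite ler_nat ltnW // ltn_expl.
exists k => x Lx.
have nk0 : 0 < (n ^ k)%:R :> R by rewrite ltr0n expn_gt0; lia.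
have Dx v : tangent (carrier S) (\val x) v ->
    `|differential (root k) x v - v| <= c * `|v|.
  move=> tan; have e := congr1 Num.norm (root_differential k Lx tan).
  rewrite normrZ ger0_norm ?ler0n // in e.
  rewrite -(ler_pM2l nk0) -[leLHS]e; apply: le_trans (ler_normB _ _) _.
  apply: (@le_trans _ _ ((`|K| + 1) * `|v|)).
    rewrite mulrDl mul1r lerD2r; apply: le_trans (bd _ _ Lx tan) _.
    by rewrite ler_wpM2r // ler_norm.
  by rewrite mulrA ler_wpM2r // [leRHS]mulrC.
have c2 : c < c * 2 by lra.
have nD := near_differential_sub_id (ltW c0) c2 (root_fix k Lx)
  (root_C1_at k Lx) Dx.
have nC := near_C1_at (root_C1_at k Lx).
have c02 : 0 < c / 2 by rewrite divr_gt0.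
have cr : \val (root k y) @[y --> x] --> \val (root k x).
  exact (@continuous_cvg _ _ _ (nbhs x) _ _ _ _ (@val_continuous _ S (root k x))
    (@hfun_continuous _ (root k) x)).
have /cvgrPdist_lt /(_ _ c02) n1 := cr; rewrite (root_fix k Lx) in n1.
have /cvgrPdist_lt /(_ _ c02) n2' := @val_continuous _ S x.
near=> y; split; first by near: y.
have Dy : forall v, tangent (carrier S) (\val y) v ->
  `|differential (root k) y v - v| <= c * 2 * `|v| by near: y.
have h1 : `|\val x - \val (root k y)| < c / 2 by near: y.
have h2 : `|\val x - \val y| < c / 2 by near: y.
have sup_le : (opnorm_diff_sub_id (root k) y <= (3 * (c * 2))%:E)%E.
  apply: ge_ereal_sup => _ [v [tan v1] <-]; rewrite lee_fin.
  apply: le_trans (enorm_le_norm _) _; rewrite ler_wpM2l //.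
  apply: le_trans (Dy v tan) _.
  have v_le1 := norm_le_enorm v; rewrite v1 in v_le1.
  by rewrite ler_piMr // mulr_ge0 // ltW.
have val_le : enorm (\val (root k y) - \val y) <= 3 * c.
  apply: le_trans (enorm_le_norm _) _; rewrite ler_wpM2l //.
  apply: (ltW (le_lt_trans (ler_distD (\val x) _ _) _)).
  by rewrite distrC [ltRHS]splitr ltrD.
apply: (@le_lt_trans _ _ ((3 * c)%:E + (3 * (c * 2))%:E)%E).
  by apply: leeD; rewrite ?lee_fin.
by rewrite -EFinD lte_fin /c; lra.
Unshelve. all: by end_near. Qed.

End Root.
End Main.

(** * The theorem *)

Theorem theorem1 (R : realType) (S : closed_oriented_surface R)
    (n : nat) (hn : (2 <= n)%N) (f h : homeo S) (L : set S)
    (fh_faithful : faithful_BS_action n f h)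
    (L_minimal : minimal_set f h L)
    (L_fix : L `<=` Fix f)
    (f_C1 : C1_diffeo_near L f) (h_C1 : C1_diffeo_near L h) :
  (forall (x : S) (l : R[i]), L x -> diff_eigenvalue f x l ->
     exists m : nat, (0 < m)%N /\ l ^+ m = 1) /\
  exists N : nat, [/\ (0 < N)%N,
    (forall (x : S) (l : R[i]), L x ->
       (diff_eigenvalue (iter N f) x l <-> l = 1)) &
    (* rho is an arbitrary bound on the radii, for instance the injectivity
       radius of S *)
    forall eps rho : R, 0 < eps -> 0 < rho ->
      exists (delta : R) (fe : homeo S),
      [/\ 0 < delta < rho,
          generated f h fe /\ C1_diffeo_near L fe,
          [/\ faithful_BS_action n fe h, L `<=` Fix fe
            & Fix fe `<=` Fix (iter N f)],
          [/\ forall x, snbhd L delta x -> C1_at fe x,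
              (C1_norm_sub_id fe (snbhd L delta) <= eps%:E)%E
            & snbhd L delta `<=` Veps eps fe]
        & (fe : S -> S) = iter N f \/
          exists k : nat, iter (n ^ k) fe = iter N f]].
Proof.
have [act _] := fh_faithful.
have [N N0 unip] := unipotent_power hn act L_minimal L_fix f_C1 h_C1.
have cf x : L x -> C1_at f x.
  by move=> Lx; have [] := (C1_diffeo_nearP L f).1 f_C1 x Lx.
have cfN x : L x -> C1_at (iter N f) x.
  by apply: C1_at_iter => // y Ly; rewrite (L_fix _ Ly).
have fNx x : L x -> Fix (iter N f) x.
  by move=> Lx; rewrite /Fix /=; elim: (N) => //= i ->; exact: L_fix.
pose c : {rmorphism 'M[R]_2 -> 'M[R[i]]_2} := map_mx (real_complex R).
have cunip x : L x -> (c (dmx f x) ^+ N - 1) ^+ 2 = 0.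
  by move=> /unip /(congr1 c); rewrite rmorphXn rmorphB rmorphXn rmorph1 rmorph0.
have ev x l : L x -> diff_eigenvalue (iter N f) x l <-> l = 1.
  move=> Lx; apply: (iff_trans (diff_eigenvalueP l (fNx x Lx) (cfN x Lx))).
  rewrite (dmx_iter N (L_fix _ Lx) (cf x Lx)).
  rewrite (rmorphXn c N (dmx f x)).
  exact/unipotent_eigenvalue/cunip.
split.
  move=> x l Lx /(diff_eigenvalueP l (L_fix _ Lx) (cf x Lx)) el.
  exists N; split => //; apply/(unipotent_eigenvalue _ (cunip x Lx)).
  exact: eigenvalue_exp.
exists N; split => // eps rho eps0 rho0.
have [k near_k] := root_close hn act L_minimal L_fix f_C1 h_C1 N0 unip eps0.
pose fe := conj_root f h N k.
have feL x : L x -> fe x = x by exact: (root_fix L_minimal L_fix).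
have [d d0 dO] := lebesgue_number (let: And4 _ cL _ _ := L_minimal in cL) near_k.
have m0 : 0 < Num.min rho d by rewrite lt_min rho0.
exists (Num.min rho d / 2), fe.
have sub y : snbhd L (Num.min rho d / 2) y ->
    C1_at fe y /\ (C1_dist_id_at fe y < eps%:E)%E.
  move=> [x Lx xy]; apply: (dO x y Lx).
  apply: le_lt_trans (norm_le_sdist _ xy) _; first by rewrite divr_ge0 // ltW.
  have : Num.min rho d <= d by rewrite ge_min lexx orbT.
  lra.
split.
- rewrite divr_gt0 //=; have : Num.min rho d <= rho by rewrite ge_min lexx.
  lra.
- split; last exact: (root_C1 L_minimal).
  by eexists; [|exact: conj_rootE].
- split => //; first exact: conj_root_faithful R _ _ _ _ _ _ hn N0 fh_faithful.
  move=> x fex; rewrite /Fix /= -(iter_conj_root act N k) -/fe.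
  by elim: (n ^ k)%N => //= i ->.
- split.
  + by move=> x /sub [].
  + by apply: ge_ereal_sup => _ [x /sub [_ /ltW ?] <-].
  + by move=> x /sub.
- by right; exists k; exact: iter_conj_root.
Qed.
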